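(* For partitions $\lambda,\mu$ with $\mu\subseteq\lambda$, \[ \omega\big(g_{\lambda/\mu}(\mathbf x;\boldsymbol\alpha,\boldsymbol\beta)\big)=g_{\lambda'/\mu'}(\mathbf x;-\boldsymbol\beta,-\boldsymbol\alpha). \]
   Context: $\lambda',\mu'$ are transposes. A (left-)marked reverse plane partition of shape $\lambda/\mu$ is a filling $T$ by positive integers weakly increasing along rows and columns, in which each $T(i,j)$ with $(i,j+1)$ in the shape and $T(i,j)=T(i,j+1)$ may be marked. Weight $\mathrm{wt}(T)=\prod_{(i,j)}w(i,j)$ with $w=-\alpha_j$ if $T(i,j)$ is marked; $w=\beta_{i-1}$ if unmarked, $(i-1,j)$ is in the shape and $T(i,j)=T(i-1,j)$; $w=x_{T(i,j)}$ otherwise. $g_{\lambda/\mu}(\mathbf x;\boldsymbol\alpha,\boldsymbol\beta)$ is the sum of $\mathrm{wt}(T)$ over all marked reverse plane partitions of shape $\lambda/\mu$; it is a symmetric function in $\mathbf x$ with coefficients in $\mathbb Z[\boldsymbol\alpha,\boldsymbol\beta]$. $g_{\lambda'/\mu'}(\mathbf x;-\boldsymbol\beta,-\boldsymbol\alpha)$ is obtained by substituting $\alpha_i\mapsto-\beta_i$, $\beta_i\mapsto-\alpha_i$. $\omega$ is the involution of symmetric functions with $\omega(h_n)=e_n$, extended linearly over $\mathbb Z[\boldsymbol\alpha,\boldsymbol\beta]$. *)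

(* Defs.v *)
From HB Require Import structures.
From mathcomp Require Import all_boot all_order all_fingroup all_algebra.
From mathcomp Require Import boolp.
From mathcomp.multinomials Require Import mpoly.
From mathcomp.multinomials Require monalg.

Set Implicit Arguments.
Unset Strict Implicit.
Unset Printing Implicit Defensive.

Import GRing.Theory.
Local Open Scope ring_scope.

(* Families (p_n)_n with p_n a polynomial in the first n variables. *)
Definition mpolyfam (R : comNzRingType) : Type := forall n, {mpoly R[n]}.

HB.instance Definition _ (R : comNzRingType) := Choice.on (mpolyfam R).

Section Fam.
Variable R : comNzRingType.
Implicit Types f g h : mpolyfam R.

Definition fam_zero : mpolyfam R := fun=> 0.
Definition fam_opp f : mpolyfam R := fun n => - f n.
Definition fam_add f g : mpolyfam R := fun n => f n + g n.
Definition fam_one : mpolyfam R := fun=> 1.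
Definition fam_mul f g : mpolyfam R := fun n => f n * g n.
Definition fam_scale (c : R) f : mpolyfam R := fun n => c *: f n.

Fact fam_addA : associative fam_add.
Proof. by move=> f g h; apply: functional_extensionality_dep => n; exact: addrA. Qed.
Fact fam_addC : commutative fam_add.
Proof. by move=> f g; apply: functional_extensionality_dep => n; exact: addrC. Qed.
Fact fam_add0 : left_id fam_zero fam_add.
Proof. by move=> f; apply: functional_extensionality_dep => n; exact: add0r. Qed.
Fact fam_addN : left_inverse fam_zero fam_opp fam_add.
Proof. by move=> f; apply: functional_extensionality_dep => n; exact: addNr. Qed.
HB.instance Definition _ := GRing.isZmodule.Build (mpolyfam R)
  fam_addA fam_addC fam_add0 fam_addN.

Fact fam_mulA : associative fam_mul.
Proof. by move=> f g h; apply: functional_extensionality_dep => n; exact: mulrA. Qed.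
Fact fam_mulC : commutative fam_mul.
Proof. by move=> f g; apply: functional_extensionality_dep => n; exact: mulrC. Qed.
Fact fam_mul1 : left_id fam_one fam_mul.
Proof. by move=> f; apply: functional_extensionality_dep => n; exact: mul1r. Qed.
Fact fam_mulDl : left_distributive fam_mul fam_add.
Proof. by move=> f g h; apply: functional_extensionality_dep => n; exact: mulrDl. Qed.
Fact fam_one_neq0 : fam_one != 0.
Proof.
by apply/eqP => /(congr1 (fun f : mpolyfam R => f 0%N)) /eqP; rewrite oner_eq0.
Qed.
HB.instance Definition _ := GRing.Zmodule_isComNzRing.Build (mpolyfam R)
  fam_mulA fam_mulC fam_mul1 fam_mulDl fam_one_neq0.

Fact fam_scaleA a b f : fam_scale a (fam_scale b f) = fam_scale (a * b) f.
Proof. by apply: functional_extensionality_dep => n; exact: scalerA. Qed.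
Fact fam_scale1 : left_id 1 fam_scale.
Proof. by move=> f; apply: functional_extensionality_dep => n; exact: scale1r. Qed.
Fact fam_scaleDr : right_distributive fam_scale +%R.
Proof. by move=> a f g; apply: functional_extensionality_dep => n; exact: scalerDr. Qed.
Fact fam_scaleDl f : {morph fam_scale^~ f : a b / a + b}.
Proof. by move=> a b; apply: functional_extensionality_dep => n; exact: scalerDl. Qed.
HB.instance Definition _ := GRing.Zmodule_isLmodule.Build R (mpolyfam R)
  fam_scaleA fam_scale1 fam_scaleDr fam_scaleDl.
Fact fam_scaleAl (a : R) (f g : mpolyfam R) : a *: (f * g) = a *: f * g.
Proof. by apply: functional_extensionality_dep => n; exact: scalerAl. Qed.
HB.instance Definition _ := GRing.Lmodule_isLalgebra.Build R (mpolyfam R) fam_scaleAl.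
End Fam.

(* The homomorphism setting the last variable to 0. *)
Definition mrestr (R : comNzRingType) n (p : {mpoly R[n.+1]}) : {mpoly R[n]} :=
  p \mPo [tuple oapp (fun j : 'I_n => 'X_j) 0 (unlift ord_max i) | i < n.+1].

HB.instance Definition _ (R : comNzRingType) n :=
  GRing.LRMorphism.copy (@mrestr R n) (comp_mpoly _).

(* A symmetric function f (a symmetric formal power series of bounded degree in *)
(* x_1, x_2, ...) is encoded by its specializations f(x_1, ..., x_n, 0, 0, ...). *)
Definition issymfun (R : comNzRingType) : pred (mpolyfam R) := fun f =>
  `[< [/\ forall n, f n \is symmetric,
          forall n, mrestr (f n.+1) = f n
        & exists d, forall n, msize (f n) <= d]%N >].

Fact issymfun_subalg (R : comNzRingType) : subalg_closed (@issymfun R).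
Proof.
split.
- apply/asboolP; split=> [n|n|]; first exact: rpred1; first exact: rmorph1.
  by exists 1%N => n; rewrite msize1.
- move=> a f g /asboolP[fs fr [d fd]] /asboolP[gs gr [e ge]].
  apply/asboolP; split=> [n|n|].
  + by have: a *: f n + g n \is symmetric by rewrite rpredD ?rpredZ ?fs ?gs.
  + by have: mrestr (a *: f n.+1 + g n.+1) = a *: f n + g n by rewrite linearP /= fr gr.
  + exists (maxn d e) => n; apply: leq_trans (msizeD_le _ _) _.
    rewrite geq_max !leq_max ge orbT andbT (leq_trans (msizeZ_le _ _)) //=.
- move=> f g /asboolP[fs fr [d fd]] /asboolP[gs gr [e ge]].
  apply/asboolP; split=> [n|n|].
  + by have: f n * g n \is symmetric by rewrite rpredM ?fs ?gs.
  + by have: mrestr (f n.+1 * g n.+1) = f n * g n by rewrite rmorphM /= fr gr.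
  + by exists (d + e).+1 => n; apply: leq_trans (msizeM_le _ _) _; rewrite ltnS leq_add.
Qed.
HB.instance Definition _ (R : comNzRingType) :=
  GRing.isSubalgClosed.Build R (mpolyfam R) (@issymfun R) (@issymfun_subalg R).

Record symfun (R : comNzRingType) := SymFun {
  symfun_val :> mpolyfam R;
  _ : issymfun symfun_val }.
HB.instance Definition _ (R : comNzRingType) := [isSub for @symfun_val R].
HB.instance Definition _ (R : comNzRingType) := [Choice of symfun R by <:].
HB.instance Definition _ (R : comNzRingType) :=
  [SubChoice_isSubComNzRing of symfun R by <:].
HB.instance Definition _ (R : comNzRingType) :=
  [SubZmodule_isSubLmodule of symfun R by <:].
HB.instance Definition _ (R : comNzRingType) :=
  [SubNzRing_SubLmodule_isSubLalgebra of symfun R by <:].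

Section EH.
Variable R : comNzRingType.

Lemma lift_max_widen n (j : 'I_n) : lift ord_max j = widen_ord (leqnSn n) j.
Proof. by apply/val_inj; rewrite /= /bump leqNgt ltn_ord. Qed.

Lemma mrestrX n (m : 'X_{1..n.+1}) :
  mrestr 'X_[R, m] = if m ord_max == 0%N
    then 'X_[[multinom m (widen_ord (leqnSn n) i) | i < n]] else 0.
Proof.
rewrite /mrestr comp_mpolyX big_ord_recr /= tnth_mktuple unlift_none /= expr0n.
case: ifP => [/eqP m0|m0]; last by rewrite mulr0.
rewrite mulr1 [RHS]mpolyXE_id; apply: eq_bigr => i _.
by rewrite tnth_mktuple -lift_max_widen liftK mnmE lift_max_widen.
Qed.

Lemma mcoeff_mrestr n (p : {mpoly R[n.+1]}) m :
  (mrestr p)@_m = p@_(mnmwiden m).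
Proof.
elim/mpolyind: p => [|c m' p _ _ IH]; first by rewrite [mrestr 0]raddf0 !mcoeff0.
rewrite [mrestr _]linearP /= !mcoeffD !mcoeffZ {}IH mrestrX !mcoeffX.
congr (_ * _ + _); have [m0|m0] := eqVneq (m' ord_max) 0%N; last first.
  rewrite mcoeff0; case: eqP => // E; case/eqP: m0.
  by rewrite E mnmwiden_ordmax.
rewrite mcoeffX; congr (nat_of_bool _)%:R; apply/eqP/eqP => [<-|->].
  apply/mnmP => i; case: (unliftP ord_max i) => [j ->|->].
    by rewrite lift_max_widen mnmwiden_widen mnmE.
  by rewrite mnmwiden_ordmax m0.
by apply/mnmP => i; rewrite mnmE mnmwiden_widen.
Qed.

Lemma mdeg_mnmwiden n (m : 'X_{1..n}) : mdeg (mnmwiden m) = mdeg m.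
Proof.
rewrite !mdegE big_ord_recr /= mnmwiden_ordmax addn0.
by apply: eq_bigr => i _; rewrite mnmwiden_widen.
Qed.

Definition mhsym n k : {mpoly R[n]} :=
  \sum_(m : 'X_{1..n < k.+1} | mdeg m == k) 'X_[m].

Lemma mcoeff_mhsym n k m : (mhsym n k)@_m = (mdeg m == k)%:R.
Proof.
rewrite /mhsym raddf_sum /=.
under eq_bigr do rewrite mcoeffX.
have [mk|mk] := eqVneq (mdeg m) k; last first.
  rewrite big1 // => i /eqP ik; case: eqP => // E.
  by rewrite -E ik eqxx in mk.
have lt_mk : (mdeg m < k.+1)%N by rewrite mk.
rewrite (bigD1 (BMultinom lt_mk)) /= ?mk // eqxx big1 ?addr0 // => i /andP[_ ne].
by case: eqP => // E; case/eqP: ne; apply/val_inj.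
Qed.

Lemma msize_le n (p : {mpoly R[n]}) d :
  (forall m, (d <= mdeg m)%N -> p@_m = 0) -> (msize p <= d)%N.
Proof.
move=> H; rewrite msizeE; apply/bigmax_leqP_seq => m mp _.
rewrite ltnNge; apply/negP => /H /eqP; by rewrite mcoeff_eq0 mp.
Qed.

Fact esym_proof k : issymfun (fun n => mesym n R k).
Proof.
apply/asboolP; split=> [n|n|].
- exact: mesym_sym.
- apply/mpolyP => m; rewrite mcoeff_mrestr !mcoeff_mesym /mechar mdeg_mnmwiden.
  congr ((_ && _) : bool)%:R; apply/forallP/forallP => H i.
    by have := H (widen_ord (leqnSn n) i); rewrite mnmwiden_widen.
  case: (unliftP ord_max i) => [j ->|->].
    by rewrite lift_max_widen mnmwiden_widen.
  by rewrite mnmwiden_ordmax.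
- exists k.+1 => n; apply: msize_le => m km.
  by rewrite mcoeff_mesym /mechar gtn_eqF.
Qed.

Fact hsym_proof k : issymfun (fun n => mhsym n k).
Proof.
apply/asboolP; split=> [n|n|].
- by apply/issymP => s; apply/mpolyP => m; rewrite mcoeff_sym !mcoeff_mhsym mdeg_mperm.
- by apply/mpolyP => m; rewrite mcoeff_mrestr !mcoeff_mhsym mdeg_mnmwiden.
- by exists k.+1 => n; apply: msize_le => m km; rewrite mcoeff_mhsym gtn_eqF.
Qed.

Definition sym_e k : symfun R := SymFun (esym_proof k).
Definition sym_h k : symfun R := SymFun (hsym_proof k).

Lemma mesym_mhsym n k : (0 < k)%N ->
  \sum_(i < k.+1) (-1) ^+ i * mesym n R i * mhsym n (k - i) = 0.
Proof.
move=> k0; apply/mpolyP => m; rewrite mcoeff0 raddf_sum /=.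
have E (i : 'I_k.+1) : ((-1) ^+ i * mesym n R i * mhsym n (k - i))@_m =
   \sum_(A : {set 'I_n} | #|A| == i) (-1) ^+ #|A| *+ ((mesym1 A <= m)%MM && (mdeg m == k)).
  rewrite mesymE [_ ^+ i * _]mulr_sumr mulr_suml raddf_sum; apply: eq_bigr => A /eqP Ai /=.
  rewrite -mulrA -mpolyC1 -mpolyCN -rmorphXn /= mcoeffCM mulrC Ai.
  have [le|le] := boolP (mesym1 A <= m)%MM; last first.
    rewrite mulrC [X in _ * X]memN_msupp_eq0 ?mulr0 //.
    apply: contra le => /msuppM_le /allpairsP[[m1 m2] /= [+ _ ->]].
    by rewrite msuppX inE => /eqP ->; apply/mnm_lepP => j; rewrite mnmDE leq_addr.
  have ik : (i <= k)%N by rewrite -ltnS.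
  have -> : (mdeg m == k) = (mdeg (m - mesym1 A)%MM == k - i)%N.
    by rewrite -[in LHS](submK le) mdegD mdeg_mesym1 Ai -[X in _ == X](subnK ik) eqn_add2r.
  rewrite ['X_[_] * _]mulrC -{1}(submK le) [(_ - _ + _)%MM]addmC mcoeffMX.
  by rewrite mcoeff_mhsym mulr_natl.
under eq_bigr do rewrite E.
have [mk|mk] := eqVneq (mdeg m) k; last first.
  by rewrite big1 // => i _; rewrite big1 // => A _; rewrite andbF.
have [i0 mi0] : exists i0, (0 < m i0)%N.
  apply/existsP; apply: contraLR k0; rewrite negb_exists -mk => /forallP H.
  rewrite -leqNgt mdegE big1 // => i _; apply/eqP; by rewrite -leqn0 leqNgt.
rewrite (exchange_big_dep predT) //=.
transitivity (\sum_(A : {set 'I_n}) (-1) ^+ #|A| *+ (mesym1 A <= m)%MM : R).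
  apply: eq_bigr => A _; rewrite andbT.
  have [le|le] := boolP (mesym1 A <= m)%MM; last by rewrite mulr0n big1.
  have Ak : (#|A| < k.+1)%N.
    by rewrite ltnS -mk -(submK le) mdegD mdeg_mesym1 leq_addl.
  rewrite (bigD1 (Ordinal Ak)) //= big1 ?addr0 // => i /andP[/eqP Ai /eqP []].
  by apply/val_inj.
rewrite (bigID (fun A : {set 'I_n} => i0 \in A)) /=.
rewrite (reindex_onto (fun A => i0 |: A) (fun A => A :\ i0)) /=; last first.
  by move=> A iA; rewrite setD1K.
rewrite [X in X + _](eq_big (fun A : {set 'I_n} => i0 \notin A)
   (fun A : {set 'I_n} => - ((-1) ^+ #|A| *+ (mesym1 A <= m)%MM) : R)).
- by rewrite sumrN addNr.
- move=> A; rewrite setU11 /=; apply/eqP/idP => [<-|iA]; last by rewrite setU1K.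
  by rewrite !inE eqxx.
move=> A /andP[_ /eqP EA]; have iA : i0 \notin A by rewrite -EA !inE eqxx.
rewrite cardsU1 iA /= exprS mulN1r mulNrn; congr (- (_ *+ nat_of_bool _)).
apply/mnm_lepP/mnm_lepP => H j; have := H j; rewrite !mnmE !inE.
  by case: eqP => //= _; case: (j \in A).
by case: eqP => //= -> _.
Qed.

Definition sf_spec n (f : symfun R) : {mpoly R[n]} := symfun_val f n.
Fact sf_spec_is_linear n : linear (@sf_spec n). Proof. by []. Qed.
Fact sf_spec_is_monoid_morphism n : monoid_morphism (@sf_spec n).
Proof. by []. Qed.
HB.instance Definition _ n :=
  GRing.isLinear.Build R (symfun R) {mpoly R[n]} *:%R (@sf_spec n) (@sf_spec_is_linear n).
HB.instance Definition _ n :=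
  GRing.isMonoidMorphism.Build (symfun R) {mpoly R[n]} (@sf_spec n)
    (@sf_spec_is_monoid_morphism n).

Lemma symfunP (f g : symfun R) : (forall n, sf_spec n f = sf_spec n g) -> f = g.
Proof. by move=> fg; apply/val_inj/functional_extensionality_dep. Qed.

Lemma sym_eh k : (0 < k)%N ->
  \sum_(i < k.+1) (-1) ^+ i * sym_e i * sym_h (k - i) = 0.
Proof.
move=> k0; apply: symfunP => n; rewrite rmorph0 rmorph_sum.
rewrite -[RHS](mesym_mhsym n k0); apply: eq_bigr => i _.
by rewrite !rmorphM rmorphXn rmorphN1.
Qed.
End EH.

Section Omega.
Variable R : comNzRingType.
Implicit Types F G : symfun R.

Local Notation S n := [tuple mesym n R i.+1 | i < n].

Definition sf_eval (u : nat -> symfun R) n (p : {mpoly R[n]}) : symfun R :=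
  mmap (in_alg (symfun R)) (fun i : 'I_n => u i.+1) p.
HB.instance Definition _ u n := GRing.RMorphism.copy (@sf_eval u n) (mmap _ _).

Fact sf_eval_scalable u n : scalable (@sf_eval u n).
Proof. by move=> a p; rewrite /sf_eval mmapZ mulr_algl. Qed.
HB.instance Definition _ u n :=
  GRing.isScalable.Build R {mpoly R[n]} (symfun R) *:%R (@sf_eval u n)
    (@sf_eval_scalable u n).

Lemma symfE n (t : {mpoly R[n]}) : symf (t \mPo S n) = t.
Proof.
apply: msym_fundamental_un; rewrite -symfP //; apply: mcomp_sym => i.
by rewrite (nth_map i) ?size_enum_ord // mesym_sym.
Qed.

Lemma mrestrXU n (i : 'I_n.+1) :
  mrestr 'X_i = oapp (fun j : 'I_n => 'X_j) (0 : {mpoly R[n]}) (unlift ord_max i).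
Proof. by rewrite /mrestr comp_mpolyXU -tnth_nth tnth_mktuple. Qed.

Lemma mrestr_e n k : mrestr (mesym n.+1 R k) = mesym n R k.
Proof. by case/asboolP: (esym_proof R k) => _ ->. Qed.

Lemma mrestr_comp n (t : {mpoly R[n.+1]}) :
  mrestr t \mPo S n = mrestr (t \mPo S n.+1).
Proof.
elim/mpolyind: t => [|c m p _ _ IH].
  by rewrite comp_mpoly0 /mrestr !comp_mpoly0.
rewrite [mrestr (_ + _)]linearP [LHS]linearP [X in mrestr X]linearP [RHS]linearP /= IH.
congr (_ *: _ + _); rewrite mpolyXE_id !rmorph_prod.
apply: eq_bigr => i _; rewrite !rmorphXn /= comp_mpolyXU -tnth_nth tnth_mktuple.
rewrite mrestrXU mrestr_e; congr (_ ^+ _).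
case: (unliftP ord_max i) => [j ->|->] /=.
  by rewrite comp_mpolyXU -tnth_nth tnth_mktuple /bump leqNgt ltn_ord.
by rewrite comp_mpoly0 mesym_geqnE.
Qed.

Lemma symf_mrestr F n : symf (sf_spec n F) = mrestr (symf (sf_spec n.+1 F)).
Proof.
case/asboolP: (valP F) => Fs Fr _.
rewrite -[RHS]symfE mrestr_comp -symfP; last exact: Fs.
by rewrite (Fr n).
Qed.

Lemma sf_eval_mrestr u n (t : {mpoly R[n.+1]}) :
  (mweight t <= n)%N -> sf_eval u (mrestr t) = sf_eval u t.
Proof.
move=> wt; have E : t = \sum_(m <- msupp t) t@_m *: 'X_[m] by exact: mpolyE.
have mrestr_sum : mrestr t = \sum_(m <- msupp t) t@_m *: mrestr 'X_[m].
  rewrite {1}E [LHS]linear_sum; apply: eq_bigr => m _; exact: linearZ.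
rewrite mrestr_sum {3}E [LHS]linear_sum [RHS]linear_sum.
apply: eq_big_seq => m mt; rewrite [LHS]linearZ [RHS]linearZ; congr (_ *: _).
have m0 : m ord_max = 0%N.
  have := leq_trans (mmeasure_mnm_lt _ mt) wt.
  rewrite /= /mnmwgt big_ord_recr /=; case: (m ord_max) => // k.
  by rewrite mulSn ltnNge => /negP[]; rewrite addnCA (leq_trans (leqnSn n)) ?leq_addr.
rewrite mrestrX m0 eqxx /= /sf_eval !mmapX /mmap1 big_ord_recr /= m0 expr0 mulr1.
by apply: eq_bigr => i _; rewrite mnmE.
Qed.

Definition sf_bound F d := forall n, (msize (sf_spec n F) <= d)%N.

Lemma sf_eval_stable u F d N : sf_bound F d -> (d <= N)%N ->
  sf_eval u (symf (sf_spec N F)) = sf_eval u (symf (sf_spec d F)).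
Proof.
move=> Fd; elim: N => [|N IH]; first by rewrite leqn0 => /eqP ->.
rewrite leq_eqVlt => /predU1P[->//|dN]; rewrite -IH // (symf_mrestr F N) sf_eval_mrestr //.
case/asboolP: (valP F) => Fs Fr _.
have [t [E wt]] := sym_fundamental (Fs N.+1).
rewrite -[sf_spec N.+1 F]E symfE (leq_trans wt) // (leq_trans (Fd _)) //.
Qed.

Fact sf_bound_ex F : exists d, sf_bound F d.
Proof. by case/asboolP: (valP F). Qed.

Fact sf_spec_sym F n : sf_spec n F \is symmetric.
Proof. by case/asboolP: (valP F) => H _ _; exact: H. Qed.

Fact sf_spec_mrestr F n : mrestr (sf_spec n.+1 F) = sf_spec n F.
Proof. by case/asboolP: (valP F) => _ H _; exact: H. Qed.

Lemma sf_spec_eq_le F G m n : (m <= n)%N ->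
  sf_spec n F = sf_spec n G -> sf_spec m F = sf_spec m G.
Proof.
elim: n => [|n IH]; first by rewrite leqn0 => /eqP ->.
rewrite leq_eqVlt => /predU1P[-> //|mn] E; apply: IH => //.
by rewrite -(sf_spec_mrestr F) -(sf_spec_mrestr G) E.
Qed.

Lemma sf_eval_spec u n k (p : {mpoly R[n]}) :
  sf_spec k (sf_eval u p) = p \mPo [tuple sf_spec k (u i.+1) | i < n].
Proof.
elim/mpolyind: p => [|c m p _ _ IH].
  by rewrite comp_mpoly0 [sf_eval u 0]raddf0 raddf0.
have -> : sf_eval u (c *: 'X_[m] + p) = c *: sf_eval u 'X_[m] + sf_eval u p.
  exact: linearP.
have -> : sf_spec k (c *: sf_eval u 'X_[m] + sf_eval u p) =
  c *: sf_spec k (sf_eval u 'X_[m]) + sf_spec k (sf_eval u p) by exact: linearP.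
rewrite [RHS]linearP /= IH; congr (_ *: _ + _).
rewrite /sf_eval mmapX comp_mpolyX rmorph_prod; apply: eq_bigr => i _.
by rewrite rmorphXn tnth_mktuple.
Qed.

Lemma sf_eval_symf F d N : sf_bound F d -> (d <= N)%N ->
  F = sf_eval (sym_e R) (symf (sf_spec N F)).
Proof.
move=> Fd dN; rewrite (sf_eval_stable _ Fd dN); apply: symfunP => n.
apply: (@sf_spec_eq_le _ _ _ (maxn n d)); first exact: leq_maxl.
rewrite -(sf_eval_stable _ Fd (leq_maxr n d)) sf_eval_spec.
exact: (symfP (sf_spec_sym F (maxn n d))).
Qed.

Lemma lrmorph_sf_eval (w : {lrmorphism symfun R -> symfun R}) u n (p : {mpoly R[n]}) :
  w (sf_eval u p) = sf_eval (w \o u) p.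
Proof.
elim/mpolyind: p => [|c m p _ _ IH]; first by rewrite !raddf0.
have E v : sf_eval v (c *: 'X_[m] + p) = c *: sf_eval v 'X_[m] + sf_eval v p.
  exact: linearP.
rewrite !E [LHS]linearP /= IH; congr (_ *: _ + _).
rewrite /sf_eval !mmapX rmorph_prod; apply: eq_bigr => i _.
by rewrite rmorphXn.
Qed.

(* F = p(e_1, ..., e_d) for a unique polynomial p (symf, from mpoly), and omega F *)
(* is p(h_1, ..., h_d). By omega_h and omega_unique, omega is the only algebra     *)
(* endomorphism with omega(h_k) = e_k for all k.                                   *)
Definition omega F : symfun R :=
  let d := projT1 (cid (sf_bound_ex F)) in sf_eval (sym_h R) (symf (sf_spec d F)).

Lemma omegaE F : exists d, forall N, (d <= N)%N ->
  omega F = sf_eval (sym_h R) (symf (sf_spec N F)).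
Proof.
rewrite /omega; case: cid => d Fd /=.
by exists d => N dN; rewrite (sf_eval_stable _ Fd dN).
Qed.

Fact omega_is_linear : linear omega.
Proof.
move=> a F G; have [d1 E1] := omegaE F; have [d2 E2] := omegaE G.
have [d3 E3] := omegaE (a *: F + G); pose N := maxn d1 (maxn d2 d3).
rewrite (E1 N) ?(E2 N) ?(E3 N) ?leq_max ?leqnn ?orbT // -linearP; congr sf_eval.
by rewrite -[RHS]symfE; congr symf; rewrite !linearP /= -!symfP ?sf_spec_sym.
Qed.

Fact omega_is_monoid_morphism : monoid_morphism omega.
Proof.
split=> [|F G].
  have [d E] := omegaE 1; rewrite (E d) // rmorph1.
  by rewrite -[X in symf X](comp_mpoly1 (S d)) symfE rmorph1.
have [d1 E1] := omegaE F; have [d2 E2] := omegaE G.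
have [d3 E3] := omegaE (F * G); pose N := maxn d1 (maxn d2 d3).
rewrite (E1 N) ?(E2 N) ?(E3 N) ?leq_max ?leqnn ?orbT // -rmorphM; congr sf_eval.
by rewrite -[RHS]symfE; congr symf; rewrite !rmorphM /= -!symfP ?sf_spec_sym.
Qed.

HB.instance Definition _ :=
  GRing.isLinear.Build R (symfun R) (symfun R) *:%R omega omega_is_linear.
HB.instance Definition _ :=
  GRing.isMonoidMorphism.Build (symfun R) (symfun R) omega omega_is_monoid_morphism.

Lemma sym_e0 : sym_e R 0 = 1.
Proof. by apply: symfunP => n; rewrite rmorph1 /sf_spec /= mesym0E. Qed.

Lemma sym_h0 : sym_h R 0 = 1.
Proof.
apply: symfunP => n; rewrite rmorph1 /sf_spec /=; apply/mpolyP => m.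
by rewrite mcoeff_mhsym mcoeff1 mdeg_eq0.
Qed.

Lemma sym_he k : (0 < k)%N ->
  \sum_(i < k.+1) (-1) ^+ i * sym_h R i * sym_e R (k - i) = 0.
Proof.
move=> k0; transitivity ((-1) ^+ k * \sum_(i < k.+1) (-1) ^+ i * sym_e R i * sym_h R (k - i)).
  rewrite mulr_sumr (reindex_inj rev_ord_inj) /=; apply: eq_bigr => i _.
  have ik : (i <= k)%N by rewrite -ltnS.
  rewrite subSS subKn //.
  have -> : (-1) ^+ k = (-1) ^+ (k - i) * (-1) ^+ i :> symfun R.
    by rewrite -exprD subnK.
  rewrite !mulrA -[_ ^+ (k - i) * _ ^+ i * _]mulrA -exprD addnn -mul2n exprM.
  by rewrite sqrrN !expr1n mulr1 mulrAC.
by rewrite sym_eh // mulr0.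
Qed.

Lemma lrmorph_swap (w : {lrmorphism symfun R -> symfun R}) (a b : nat -> symfun R) :
  a 0%N = 1 -> b 0%N = 1 ->
  (forall k, (0 < k)%N -> \sum_(i < k.+1) (-1) ^+ i * a i * b (k - i)%N = 0) ->
  (forall k, w (a k) = b k) -> forall k, w (b k) = a k.
Proof.
move=> a0 b0 ab wa; elim/ltn_ind=> -[|k] IH; first by rewrite a0 b0 rmorph1.
have := congr1 w (ab _ (ltn0Sn k)); rewrite rmorph0 rmorph_sum.
rewrite big_ord_recl /= expr0 mul1r a0 mul1r subn0 => /eqP.
rewrite addr_eq0 => /eqP ->.
have := ab _ (ltn0Sn k); rewrite big_ord_recr /= subnn b0 mulr1.
move/eqP; rewrite addr_eq0 => /eqP eh.
rewrite -sumrN (reindex_inj rev_ord_inj) /=.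
have -> : a k.+1 = (-1) ^+ k * \sum_(i < k.+1) (-1) ^+ i * a i * b (k.+1 - i)%N.
  rewrite eh exprS mulN1r mulNr opprK mulrA -exprD addnn -mul2n exprM.
  by rewrite sqrrN !expr1n mul1r.
rewrite mulr_sumr; apply: eq_bigr => i _; have ik : (i <= k)%N by rewrite -ltnS.
rewrite subSS /bump /= add1n subSS (subKn ik) subSn // !rmorphM rmorphXn rmorphN1 /=.
rewrite wa (IH i) // exprS mulN1r !mulNr opprK.
have -> : (-1) ^+ k = (-1) ^+ (k - i) * (-1) ^+ i :> symfun R.
  by rewrite -exprD subnK.
rewrite !mulrA -[_ ^+ (k - i) * _ ^+ i * _]mulrA -exprD addnn -mul2n exprM.
by rewrite sqrrN !expr1n mulr1 mulrAC.
Qed.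

Lemma omega_e k : omega (sym_e R k) = sym_h R k.
Proof.
case: k => [|k]; first by rewrite sym_e0 sym_h0 rmorph1.
have [d E] := omegaE (sym_e R k.+1).
pose N := maxn d k.+1; have kN : (k < N)%N by rewrite leq_max leqnn orbT.
rewrite (E N) ?leq_max ?leqnn //.
have -> : sf_spec N (sym_e R k.+1) = 'X_(Ordinal kN) \mPo S N.
  by rewrite comp_mpolyXU -tnth_nth tnth_mktuple.
by rewrite symfE /sf_eval mmapX mmap1U.
Qed.

Lemma omega_h k : omega (sym_h R k) = sym_e R k.
Proof. exact: (lrmorph_swap sym_e0 sym_h0 (@sym_eh R) omega_e). Qed.

Lemma eq_sf_eval u v n (p : {mpoly R[n]}) : u =1 v -> sf_eval u p = sf_eval v p.
Proof.
move=> uv; rewrite /sf_eval /mmap /mmap1; apply: eq_bigr => m _.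
by congr (_ * _); apply: eq_bigr => i _; rewrite uv.
Qed.

Lemma sym_e_gen F : exists n (p : {mpoly R[n]}), F = sf_eval (sym_e R) p.
Proof.
have [d Fd] := sf_bound_ex F; exists d, (symf (sf_spec d F)).
exact: sf_eval_symf Fd (leqnn d).
Qed.

Lemma omega_sf_eval u n (p : {mpoly R[n]}) :
  omega (sf_eval u p) = sf_eval (omega \o u) p.
Proof. exact: (lrmorph_sf_eval omega). Qed.

Lemma omega_unique (w : {lrmorphism symfun R -> symfun R}) :
  (forall k, w (sym_h R k) = sym_e R k) -> w =1 omega.
Proof.
move=> wh F; have we := lrmorph_swap sym_h0 sym_e0 sym_he wh.
have [n [p ->]] := sym_e_gen F; rewrite lrmorph_sf_eval omega_sf_eval.
by apply: eq_sf_eval => k /=; rewrite we omega_e.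
Qed.

Lemma omegaK : involutive omega.
Proof.
move=> F; have [n [p ->]] := sym_e_gen F; rewrite !omega_sf_eval.
by apply: eq_sf_eval => k /=; rewrite omega_e omega_h.
Qed.
End Omega.

(* Partitions, without trailing zeros. *)
Definition is_part (la : seq nat) := sorted geq la && (0%N \notin la).

Definition subpart (mu la : seq nat) := forall i, (nth 0 mu i <= nth 0 la i)%N.

Definition conj_part (la : seq nat) : seq nat :=
  mkseq (fun j => count (ltn j) la) (head 0%N la).

(* Indices start at 0: cell (i, j) is the cell in row i+1 and column j+1, the   *)
(* entry k stands for the positive integer k+1, and alpha k, beta k are         *)
(* alpha_(k+1), beta_(k+1).                                                     *)
Section MarkedRPP.
Variables (la mu : seq nat).

Definition skew_cell := {c : 'I_(size la) * 'I_(head 0%N la) |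
  (nth 0 mu c.1 <= c.2 < nth 0 la c.1)%N}.

Definition crow (c : skew_cell) : nat := (val c).1.
Definition ccol (c : skew_cell) : nat := (val c).2.

Section Filling.
Variables (n : nat) (T : {ffun skew_cell -> 'I_n}) (M : {set skew_cell}).

Definition is_rpp := [forall c, forall d,
  [|| (crow c == crow d) && (ccol c <= ccol d)
    | (ccol c == ccol d) && (crow c <= crow d)] ==> (T c <= T d)]%N.

Definition eq_right (c : skew_cell) := [exists d : skew_cell,
  [&& crow d == crow c, ccol d == (ccol c).+1 & T d == T c]].

Definition eq_above (c : skew_cell) := [exists d : skew_cell,
  [&& (crow d).+1 == crow c, ccol d == ccol c & T d == T c]].

(* M is the set of marked cells *)
Definition is_marked_rpp := is_rpp && [forall c in M, eq_right c].

Definition cell_wt (R : comNzRingType) (alpha beta : nat -> R) (c : skew_cell) :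
    {mpoly R[n]} :=
  if c \in M then (- alpha (ccol c))%:MP
  else if eq_above c then (beta (crow c).-1)%:MP
  else 'X_(T c).

End Filling.

(* Every value of a marked reverse plane partition contributes a variable to    *)
(* its weight (take the rightmost of its cells in the topmost row containing    *)
(* it), so putting x_k = 0 for k > n leaves the fillings with entries at most n. *)
Definition dual_groth (R : comNzRingType) (alpha beta : nat -> R) : mpolyfam R :=
  fun n => \sum_(TM : {ffun skew_cell -> 'I_n} * {set skew_cell}
                   | is_marked_rpp TM.1 TM.2)
             \prod_(c : skew_cell) cell_wt TM.1 TM.2 alpha beta c.

End MarkedRPP.

(* monalg redefines notations of mpoly, hence the module. *)
Module ParamRing.
Import monalg.

(* Z[alpha_1, alpha_2, ..., beta_1, beta_2, ...] *)
Definition Zab : comNzRingType := {malg int[{cmonom (nat + nat)%type}]}.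
Definition alphaZ (k : nat) : Zab := << 1 *g ucm (inl k : nat + nat)%type >>.
Definition betaZ (k : nat) : Zab := << 1 *g ucm (inr k : nat + nat)%type >>.
End ParamRing.

Notation Zab := ParamRing.Zab.
Notation alphaZ := ParamRing.alphaZ.
Notation betaZ := ParamRing.betaZ.

(* Main.v *)
(* Adding the variables one at a time writes g_{la/mu}(x_1, ..., x_n) as an entry   *)
(* of a product G(x_1) ... G(x_n) of matrices indexed by partitions: after summing  *)
(* out the marks, the one-variable function is a product over the cells of          *)
(* (label of the top edge) - (label of the right edge). Replacing the label 0 of    *)
(* the right boundary by a second parameter y gives matrices P(x, y) with           *)
(* G(x) = P(x, 0), P(x, x) = 1 and P(x, y) P(y, z) = P(x, z); the last identity is  *)
(* a telescoping sum over the rows of the intermediate partition. The same product  *)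
(* formed with bottom and left edges is equal to P(x, y), so rotating the shapes by *)
(* 180 degrees gives P(y, z) P(x, y) = P(x, z). Hence the G(x) commute, g is        *)
(* symmetric, and G(-x)^-1 = P(0, -x), which is the one-variable matrix of the      *)
(* transposed function on the right-hand side. Finally, adding a variable y         *)
(* multiplies the matrix of all g by G(y) and replaces e_k by e_k + y e_(k-1); as   *)
(* the e_k are algebraically independent, this may be read with e_k := h_k and      *)
(* y := -x_n, which shows that omega turns each factor G(x) into G(-x)^-1.          *)
Require Import Defs.
From mathcomp Require Import all_boot all_order all_algebra.
From mathcomp.multinomials Require Import mpoly.
From mathcomp Require Import ring zify.

Set Implicit Arguments.
Unset Strict Implicit.
Unset Printing Implicit Defensive.

Import GRing.Theory.
Local Open Scope ring_scope.

(** * Row weights and the sum over one row of the intermediate partition *)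

(** The sum over fillings is computed by a transfer matrix. The cells holding the largest entry form
    [la/nu] for a partition [nu], so peeling them off ([fill_sumS]) writes a sum over fillings as an
    entry of a product of one-variable matrices indexed by the partitions in the box of [la]. Write
    P(x, y) for [bi_mx]. The one-variable matrix is P(x, 0) for g ([level_mx_ur]) and, after
    reflecting the transposed shape back, P(0, -x) for the right-hand side ([level_mx_dl]). These
    two families are related by P(0, -x) P(-x, 0) = 1, the matrix analogue of H(t) E(-t) = 1.

    The core is the law P(x, y) P(y, z) = P(x, z) ([bi_mx_mul], from [skew_wt_comp]). The
    intermediate partition is summed row by row. The partial sums indexed by the length of its last
    row satisfy the linear relations [balanced]; these let the next row be summed in closed form
    ([next_row_sum]) and pass on to it ([next_row_balanced]). With the reversed law [bi_mx_mul_rev]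
    and P(x, x) = 1 ([bi_mx_diag]), the factors P(x, 0) commute.

    Commutation makes the entries symmetric, hence polynomials [tau] in the e_k. Adding a variable
    multiplies by P(y, 0) ([tau_add_var]); this is an identity of polynomials in the e_k, so it
    survives e_k := h_k. There, passing from n+1 variables to n is the substitution y := -x_(n+1),
    which yields the factors P(0, -x) ([tau_mhsym]). As [omega] sends e_k to h_k, it sends one
    product to the other ([omega_ur_symfun]). *)

Section RowWeights.
Variables (B : comNzRingType) (alpha : nat -> B).
Implicit Types (u x y z : B) (a b c p q l k m : nat).

Definition alpha_prod u a b := \prod_(a <= j < b) (u - alpha j).

Lemma alpha_prod_geq u a b : (b <= a)%N -> alpha_prod u a b = 1.
Proof. by move=> ba; rewrite /alpha_prod big_geq. Qed.

Lemma alpha_prod_cat u a b c : (a <= b <= c)%N ->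
  alpha_prod u a c = alpha_prod u a b * alpha_prod u b c.
Proof. by case/andP=> ab bc; rewrite /alpha_prod (@big_cat_nat _ _ _ b). Qed.

Lemma alpha_prod_recr u a b : (a <= b)%N ->
  alpha_prod u a b.+1 = alpha_prod u a b * (u - alpha b).
Proof. by move=> ab; rewrite /alpha_prod big_nat_recr. Qed.

Lemma alpha_prod_recl u a b : (a < b)%N ->
  alpha_prod u a b = (u - alpha a) * alpha_prod u a.+1 b.
Proof. by move=> ab; rewrite /alpha_prod big_ltn. Qed.

(* A cell with top label [u] and right label [v] has weight [u - v]; the label of *)
(* an inner edge is a parameter [beta] or [alpha], that of a top edge of the      *)
(* shape is [x], and that of a right edge of the shape is [y].                    *)
Definition row_wt x y bt q p l := \prod_(p <= j < l)
  ((if q <= j then bt else x)%N - (if j.+1 < l then alpha j else y)%N).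

Lemma row_wt_geq x y bt q p l : (l <= p)%N -> row_wt x y bt q p l = 1.
Proof. by move=> lp; rewrite /row_wt big_geq. Qed.

Lemma row_wt_over x y bt q p l : (p <= q < l)%N ->
  row_wt x y bt q p l = alpha_prod x p q * alpha_prod bt q l.-1 * (bt - y).
Proof.
case: l => [|l]; first by rewrite ltn0 andbF.
rewrite ltnS => /andP[pq ql]; rewrite /row_wt (@big_cat_nat _ _ _ q) ?(leqW ql) //=.
rewrite [X in _ * X]big_nat_recr //= ltnn ql mulrA; congr (_ * _ * _).
  by apply: eq_big_nat => j /andP[pj jq]; rewrite leqNgt jq ltnS (leq_trans jq).
by apply: eq_big_nat => j /andP[qj jl]; rewrite qj ltnS jl.
Qed.

Lemma row_wt_free x y bt q p l : (p < l <= q)%N ->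
  row_wt x y bt q p l = alpha_prod x p l.-1 * (x - y).
Proof.
case: l => [|l]; first by rewrite ltn0.
rewrite ltnS => /andP[pl lq]; rewrite /row_wt big_nat_recr //= ltnn leqNgt lq /=.
congr (_ * _); apply: eq_big_nat => j /andP[pj jl].
by rewrite ltnS jl leqNgt (leq_trans jl (ltnW lq)).
Qed.

Definition tail_sum (N : nat -> B) l m := \sum_(m <= k < l.+1) N k.

Lemma tail_sum_recl N l m : (m <= l)%N ->
  tail_sum N l m = N m + tail_sum N l m.+1.
Proof. by move=> ml; rewrite /tail_sum big_ltn. Qed.

Lemma tail_sum_gt N l m : (l < m)%N -> tail_sum N l m = 0.
Proof. by move=> ml; rewrite /tail_sum big_geq. Qed.

Definition row_split x y z bt q p l k :=
  row_wt x y bt q k l * row_wt y z bt q p k.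

(** The sum telescopes: in the term of index [k < l] the factor x - y equals (x - alpha (k-1)) - (y
    - alpha (k-1)), which makes the term a difference of two consecutive right-hand sides. *)
Lemma tail_sum_split x y z bt q p l m : (p < m <= l)%N -> (l <= q)%N ->
  tail_sum (row_split x y z bt q p l) l m =
  (y - z) * alpha_prod y p m.-1 * alpha_prod x m.-1 l.-1.
Proof.
move=> + lq; have [d dE] := ubnP (l - m); elim: d m dE => // d IH m dE pml.
case/andP: (pml) => pm ml; rewrite tail_sum_recl // /row_split.
rewrite (@row_wt_free y) ?pm ?(leq_trans ml) //.
move: ml; rewrite leq_eqVlt => /predU1P[eml|ml].
  rewrite tail_sum_gt ?eml // row_wt_geq // (@alpha_prod_geq x) //; ring.
rewrite IH ?ml ?(ltnW pm) //; [|lia|lia].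
rewrite row_wt_free ?ml //= [alpha_prod x m.-1 _]alpha_prod_recl; last by lia.
case: m pm ml {dE pml} => // m pm ml /=.
rewrite alpha_prod_recr; [ring|lia].
Qed.

Lemma sum_split x y z bt q p l : (p <= l <= q)%N ->
  tail_sum (row_split x y z bt q p l) l p = row_wt x z bt q p l.
Proof.
case/andP=> pl lq; rewrite tail_sum_recl // /row_split (@row_wt_geq y) // mulr1.
move: pl; rewrite leq_eqVlt => /predU1P[epl|pl].
  by rewrite tail_sum_gt ?epl // !row_wt_geq // addr0.
rewrite tail_sum_split ?pl ?leqnn // !row_wt_free ?pl //= (@alpha_prod_geq y) //; ring.
Qed.

(* [N k] is the sum over the first rows of the intermediate partition, the last *)
(* of these rows having length [k].                                             *)
Definition balanced x y z p l (N : nat -> B) :=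
  [/\ forall k, (p < k < l)%N ->
        (y - alpha k.-1) * N k = (x - y) * tail_sum N l k.+1
    & (p < l)%N -> (y - z) * N p = (x - y) * tail_sum N l p.+1].

(** One step of the row-by-row summation. The previous row runs from [p] (in mu) to [l] (in la), the
    current one from [p'] to [l'], and [k], [k'] are the corresponding rows of the intermediate nu.
    The overlap with the row above starts at [k] for la/nu and at [p] for nu/mu. *)
Definition next_row x y z bt p l p' l' (N : nat -> B) k' :=
  if (p' <= k' <= l')%N then
    \sum_(p <= k < l.+1 | (k' <= k)%N)
      N k * (row_wt x y bt k k' l' * row_wt y z bt p p' k')
  else 0.

Section NextRow.
Variables (x y z bt : B) (p l p' l' : nat) (N : nat -> B).
Hypotheses (pl : (p <= l)%N) (p'l' : (p' <= l')%N) (p'p : (p' <= p)%N) (l'l : (l' <= l)%N).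
Hypothesis N_bal : balanced x y z p l N.
Local Notation T := (tail_sum N l).
Local Notation N' := (next_row x y z bt p l p' l' N).
Local Notation T' := (tail_sum N' l').

(** As l' <= p <= k, the new row ends to the left of every cell of the row above, so its weight does
    not depend on [k], and the sum over [k] factors out. *)
Lemma next_row_free k' : (l' <= p)%N -> (p' <= k' <= l')%N ->
  N' k' = T p * row_split x y z bt p p' l' k'.
Proof.
move=> l'p k'l'; rewrite /next_row k'l' /tail_sum mulr_suml big_nat_cond.
rewrite [RHS]big_nat_cond; apply: eq_big => k.
  by case/andP: k'l' => ? ?; lia.
case/andP=> /andP[pk kl] k'k; congr (_ * _); rewrite /row_split.
congr (_ * _); case/andP: k'l' => p'k'; rewrite leq_eqVlt => /predU1P[->|k'l'].
  by rewrite !row_wt_geq.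
by rewrite !row_wt_free ?k'l' //=; lia.
Qed.

Lemma next_row_sum_free : (l' <= p)%N ->
  T' p' = T p * row_wt x z bt p p' l'.
Proof.
move=> l'p; rewrite -(@sum_split x y z bt p p' l') ?p'l' // /tail_sum mulr_sumr.
by apply: eq_big_nat => k; rewrite ltnS => kb; rewrite next_row_free.
Qed.

Lemma next_row_tail_free m : (l' <= p)%N -> (p' <= m)%N ->
  T' m = T p * tail_sum (row_split x y z bt p p' l') l' m.
Proof.
move=> l'p p'm; rewrite /tail_sum mulr_sumr.
apply: eq_big_nat => k /andP[mk]; rewrite ltnS => kb; rewrite next_row_free //.
by rewrite kb (leq_trans p'm).
Qed.

Lemma next_row_balanced_free : (l' <= p)%N -> balanced x y z p' l' N'.
Proof.
move=> l'p; split=> [k /andP[p'k kl']|p'l'1].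
  rewrite next_row_free ?next_row_tail_free //; try lia.
  rewrite tail_sum_split //; last by lia.
  rewrite /row_split !row_wt_free //=; try lia.
  case: k p'k kl' => // k p'k kl' /=; rewrite alpha_prod_recr; [ring|lia].
rewrite next_row_free ?next_row_tail_free //; try lia.
rewrite tail_sum_split /=; try lia.
rewrite /row_split (@row_wt_geq y) // row_wt_free //=; last by lia.
rewrite (@alpha_prod_geq y) //; ring.
Qed.

Hypothesis pl' : (p < l')%N.
Local Notation D := (alpha_prod bt p l'.-1 * (bt - z)).

(** The sum over k >= c of [N k] times the weight of a row from [c] to [l'] below it; the two
    summands are the cases where the row above starts before [l'] ([row_wt_over]) and where it does
    not ([row_wt_free]). *)
Let S c := \sum_(c <= k < l') N k * (alpha_prod x c k * alpha_prod bt k l'.-1 * (bt - y))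
  + T l' * (alpha_prod x c l'.-1 * (x - y)).

(** Downward induction on [c]: peeling off k = c leaves (x - alpha c) S (c+1), and the balance
    relation at c+1 replaces (x - y) T (c+2) by (y - alpha c) N (c+1). *)
Let S_E c : (p <= c < l')%N ->
  S c = alpha_prod bt c l'.-1 * (N c * (bt - y) + (x - y) * T c.+1).
Proof.
have [d dE] := ubnP (l' - c); elim: d c dE => // d IH c dE /andP[pc cl'].
have [c1|c1] := ltnP c.+1 l'; last first.
  have e : l' = c.+1 by apply/eqP; rewrite eqn_leq c1.
  rewrite /S e big_nat1 /= !alpha_prod_geq //; ring.
have -> : S c = N c * (alpha_prod bt c l'.-1 * (bt - y)) + (x - alpha c) * S c.+1.
  rewrite /S big_ltn // [alpha_prod x c c]alpha_prod_geq // mul1r.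
  rewrite [alpha_prod x c l'.-1]alpha_prod_recl; last by lia.
  rewrite [X in _ = _ + X]mulrDr -!addrA; congr (_ + (_ + _)); last by ring.
  rewrite mulr_sumr; apply: eq_big_nat => i /andP[ci _].
  by rewrite (@alpha_prod_recl x c) //; ring.
rewrite IH ?c1 //; try lia.
have [bal _] := N_bal; have {}bal : (y - alpha c) * N c.+1 = (x - y) * T c.+2.
  by apply: (bal c.+1); lia.
rewrite -bal (@tail_sum_recl _ _ c.+1); last by lia.
rewrite [(x - y) * _]mulrDr -bal [alpha_prod bt c _]alpha_prod_recl; last by lia.
ring.
Qed.

Let next_row_S k' : (p' <= k' < l')%N ->
  N' k' = alpha_prod x k' p * S (maxn k' p) * row_wt y z bt p p' k'.
Proof.
case/andP=> p'k' k'l'; rewrite /next_row p'k' (ltnW k'l') /=.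
under eq_bigr do rewrite mulrA.
rewrite -mulr_suml; congr (_ * _).
have -> : \sum_(p <= k < l.+1 | (k' <= k)%N) N k * row_wt x y bt k k' l' =
          \sum_(maxn k' p <= k < l.+1) N k * row_wt x y bt k k' l'.
  rewrite (big_nat_widenl (maxn k' p) p) ?leq_maxr // [LHS]big_nat_cond [RHS]big_nat_cond.
  by apply: eq_bigl => k /=; rewrite geq_max; lia.
rewrite (@big_cat_nat _ _ _ l') /=; [|lia|lia].
rewrite mulrDr; congr (_ + _).
  rewrite mulr_sumr; apply: eq_big_nat => k /andP[ck kl'].
  rewrite row_wt_over; last by lia.
  have [k'p|pk'] := leqP k' p.
    rewrite (@alpha_prod_cat x k' p k); last by lia.
    by ring.
  rewrite (@alpha_prod_geq x k' p); last by lia.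
  by ring.
rewrite [T l' * _]mulrC mulrA /tail_sum mulr_sumr; apply: eq_big_nat => k /andP[l'k kl].
rewrite row_wt_free; last by lia.
have [k'p|pk'] := leqP k' p.
  rewrite (@alpha_prod_cat x k' p l'.-1); last by lia.
  by ring.
rewrite (@alpha_prod_geq x k' p); last by lia.
by ring.
Qed.

(** By balance, (bt - y) N k' + (x - y) T (k'+1) equals (bt - alpha (k'-1)) N k', which is just the
    factor missing between the two [bt]-products. The ratio of new to old sums is thus independent
    of k'. *)
Let next_row_gt k' : (p < k' < l')%N -> N' k' = alpha_prod y p' p * D * N k'.
Proof.
case/andP=> pk' k'l'; rewrite next_row_S; last by lia.
have -> : maxn k' p = k' by lia.
rewrite S_E; last by lia.
have [bal _] := N_bal; rewrite -bal; last by lia.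
rewrite (@alpha_prod_geq x k' p); last by lia.
rewrite row_wt_over; last by lia.
rewrite (@alpha_prod_cat bt p k'.-1 l'.-1); last by lia.
rewrite [alpha_prod bt k'.-1 _]alpha_prod_recl; last by lia.
rewrite prednK; last by lia.
ring.
Qed.

Let next_row_last : N' l' = alpha_prod y p' p * D * T l'.
Proof.
rewrite /next_row p'l' leqnn /=; under eq_bigr do rewrite mulrA.
rewrite -mulr_suml row_wt_over; last by lia.
rewrite [RHS]mulrC; congr (_ * _); last by ring.
rewrite /tail_sum (big_nat_widenl l' p) ?(ltnW pl') //.
by apply: eq_bigr => k _; rewrite row_wt_geq // mulr1.
Qed.

(** Here the sum [S] starts at [p], where the second balance relation turns (bt - y) N p + (x - y) T
    (p+1) into (bt - z) N p. *)
Let next_row_le k' : (p' <= k' <= p)%N ->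
  N' k' = alpha_prod x k' p * D * N p * row_wt y z bt p p' k'.
Proof.
case/andP=> p'k' k'p; rewrite next_row_S; last by lia.
have -> : maxn k' p = p by lia.
rewrite S_E; last by lia.
have [_ bal] := N_bal; rewrite -bal; last by lia.
ring.
Qed.

Let next_tail_gt m : (p < m <= l')%N -> T' m = alpha_prod y p' p * D * T m.
Proof.
case/andP=> pm ml'; rewrite /tail_sum big_nat_recr //= next_row_last.
have -> : \sum_(m <= i < l') N' i = alpha_prod y p' p * D * \sum_(m <= i < l') N i.
  by rewrite mulr_sumr; apply: eq_big_nat => i ib; rewrite next_row_gt //; lia.
by rewrite -mulrDr /tail_sum -big_cat_nat //; lia.
Qed.

(** Downward induction from m = p: the second balance relation turns (y - z) N p + (y - alpha (m-1))
    T (p+1) into (x - alpha (m-1)) T (p+1). *)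
Let next_tail_le m : (p' < m <= p)%N ->
  T' m = alpha_prod x m.-1 p * alpha_prod y p' m.-1 * D * T p.+1.
Proof.
have [d dE] := ubnP (p - m); elim: d m dE => // d IH m dE /andP[p'm mp].
rewrite tail_sum_recl; last by lia.
rewrite next_row_le; last by lia.
rewrite row_wt_free; last by lia.
have -> : T' m.+1 = alpha_prod x m p * alpha_prod y p' m * D * T p.+1.
  move: mp; rewrite leq_eqVlt => /predU1P[emp|mp]; last by rewrite IH //; lia.
  rewrite emp next_tail_gt; last by lia.
  by rewrite [alpha_prod x p p]alpha_prod_geq // mul1r.
rewrite [alpha_prod x m.-1 p]alpha_prod_recl; last by lia.
have [_ /(_ ltac:(lia)) bal] := N_bal.
case: m p'm mp {dE} => // m p'm mp /=; rewrite (@alpha_prod_recr y) //.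
transitivity (alpha_prod x m.+1 p * D * alpha_prod y p' m *
  ((y - z) * N p + (y - alpha m) * T p.+1)); first by ring.
by rewrite bal; ring.
Qed.

Lemma next_row_sum_over :
  T' p' = T p * row_wt x z bt p p' l'.
Proof.
rewrite row_wt_over; last by lia.
rewrite tail_sum_recl // next_row_le ?leqnn // row_wt_geq // mulr1.
rewrite (tail_sum_recl _ pl).
move: p'p; rewrite leq_eqVlt => /predU1P[e|lt].
  by rewrite next_tail_gt ?e ?(@alpha_prod_geq _ p p) //; [ring|lia].
rewrite next_tail_le /=; last by lia.
by rewrite (@alpha_prod_geq y p' p') //; ring.
Qed.

Lemma next_row_balanced_over : balanced x y z p' l' N'.
Proof.
have [bal1 bal2] := N_bal; split=> [k /andP[p'k kl']|_].
  have [kp|pk] := leqP k p; last first.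
    rewrite next_row_gt ?next_tail_gt ?pk //; try lia.
    transitivity (alpha_prod y p' p * D * ((y - alpha k.-1) * N k)); first by ring.
    by rewrite bal1; [ring|lia].
  rewrite next_row_le; last by lia.
  rewrite row_wt_free; last by lia.
  have -> : T' k.+1 = alpha_prod x k p * alpha_prod y p' k * D * T p.+1.
    move: kp; rewrite leq_eqVlt => /predU1P[->|kp]; last by rewrite next_tail_le //; lia.
    rewrite next_tail_gt; last by lia.
    by rewrite (@alpha_prod_geq x p p) // mul1r.
  case: k p'k kl' kp => // k p'k kl' kp /=; rewrite (@alpha_prod_recr y) //.
  transitivity (alpha_prod x k.+1 p * D * alpha_prod y p' k * (y - alpha k) *
    ((y - z) * N p)); first by ring.
  by rewrite bal2; [ring|lia].
rewrite next_row_le ?leqnn // row_wt_geq //.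
have -> : T' p'.+1 = alpha_prod x p' p * D * T p.+1.
  move: p'p; rewrite leq_eqVlt => /predU1P[e|lt].
    by rewrite next_tail_gt ?e ?(@alpha_prod_geq _ p p) // leqnn.
  rewrite next_tail_le /=; last by lia.
  by rewrite (@alpha_prod_geq y p' p') // mulr1.
transitivity (alpha_prod x p' p * D * ((y - z) * N p)); first by ring.
by rewrite bal2; [ring|lia].
Qed.
End NextRow.

Lemma next_row_sum x y z bt p l p' l' N :
  (p <= l)%N -> (p' <= l')%N -> (p' <= p)%N -> (l' <= l)%N -> balanced x y z p l N ->
  tail_sum (next_row x y z bt p l p' l' N) l' p' =
  tail_sum N l p * row_wt x z bt p p' l'.
Proof.
move=> pl p'l' p'p l'l bal; have [l'p|pl'] := leqP l' p.
  exact: next_row_sum_free.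
exact: next_row_sum_over.
Qed.

(** When the rows do not overlap, the new sums are multiples of the terms of [row_split], which are
    balanced by telescoping. When they do, the new sums beyond [p] are a constant multiple of the
    old ones, and those up to [p] telescope as in a single row. *)
Lemma next_row_balanced x y z bt p l p' l' N :
  (p <= l)%N -> (p' <= l')%N -> (p' <= p)%N -> (l' <= l)%N -> balanced x y z p l N ->
  balanced x y z p' l' (next_row x y z bt p l p' l' N).
Proof.
move=> pl p'l' p'p l'l bal; have [l'p|pl'] := leqP l' p.
  exact: next_row_balanced_free.
exact: next_row_balanced_over.
Qed.
End RowWeights.

(** * Composition of the weights of skew shapes *)

Definition ffun_rcons n (T : finType) (g : {ffun 'I_n -> T}) (t : T) :
    {ffun 'I_n.+1 -> T} :=
  [ffun i => oapp g t (unlift ord_max i)].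

Lemma big_ffun_rcons (B : nmodType) n (T : finType)
    (P : pred {ffun 'I_n.+1 -> T}) (F : {ffun 'I_n.+1 -> T} -> B) :
  \sum_(f | P f) F f =
  \sum_g \sum_(t | P (ffun_rcons g t)) F (ffun_rcons g t).
Proof.
rewrite (reindex (fun gt => ffun_rcons gt.1 gt.2)) /=.
  by rewrite big_mkcond pair_big_dep /= [RHS]big_mkcond; apply: eq_bigr.
exists (fun f => ([ffun i => f (lift ord_max i)], f ord_max)).
  move=> [g t] _; congr pair => /=; last by rewrite ffunE unlift_none.
  by apply/ffunP => i; rewrite !ffunE liftK.
move=> f _; apply/ffunP => i; rewrite ffunE /=.
by case: unliftP => [j|] -> /=; rewrite ?ffunE.
Qed.

Section Shapes.
Variable b : nat.

Definition rows n (nu : {ffun 'I_n -> 'I_b.+1}) (i : nat) : nat :=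
  if insub i is Some o then nu o else 0%N.

(* The row above the first one is taken to have the width [b] of the box. *)
Definition prev_row (f : nat -> nat) (i : nat) : nat := if i is i'.+1 then f i' else b.

Lemma rowsE n (nu : {ffun 'I_n -> 'I_b.+1}) (i : 'I_n) : rows nu i = nu i.
Proof. by rewrite /rows valK. Qed.

Lemma rows_out n (nu : {ffun 'I_n -> 'I_b.+1}) i : (n <= i)%N -> rows nu i = 0%N.
Proof. by move=> ni; rewrite /rows insubF // ltnNge ni. Qed.

Lemma rows_le n (nu : {ffun 'I_n -> 'I_b.+1}) i : (rows nu i <= b)%N.
Proof. by rewrite /rows; case: insubP => // o _ _; rewrite -ltnS. Qed.

Lemma rows_rcons n (g : {ffun 'I_n -> 'I_b.+1}) t i : (i < n)%N ->
  rows (ffun_rcons g t) i = rows g i.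
Proof.
move=> lin; pose o := Ordinal lin.
rewrite -[i]/(nat_of_ord o) rowsE -[in LHS](lift_max o).
by rewrite (rowsE _ (lift ord_max o)) ffunE liftK.
Qed.

Lemma rows_rcons_last n (g : {ffun 'I_n -> 'I_b.+1}) t :
  rows (ffun_rcons g t) n = t.
Proof. by rewrite -[n in LHS]/(nat_of_ord (@ord_max n)) rowsE ffunE unlift_none. Qed.

Lemma prev_row_rcons n (g : {ffun 'I_n -> 'I_b.+1}) t i : (i <= n)%N ->
  prev_row (rows (ffun_rcons g t)) i = prev_row (rows g) i.
Proof. by case: i => // i lin /=; rewrite rows_rcons. Qed.

Definition is_shape n (f : nat -> nat) := forall i, (i < n)%N -> (f i <= prev_row f i)%N.
Definition is_sub n (f g : nat -> nat) := forall i, (i < n)%N -> (f i <= g i)%N.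

Definition between n (la mu : nat -> nat) (nu : {ffun 'I_n -> 'I_b.+1}) :=
  [forall i : 'I_n, (nu i <= prev_row (rows nu) i)%N && (mu i <= nu i <= la i)%N].

Lemma between_rcons n la mu (g : {ffun 'I_n -> 'I_b.+1}) t :
  between la mu (ffun_rcons g t) =
  between la mu g && ((t <= prev_row (rows g) n)%N && (mu n <= t <= la n)%N).
Proof.
apply/forallP/andP => [H|[/forallP Hg Ht] i].
  split; last by have := H ord_max; rewrite ffunE unlift_none prev_row_rcons.
  apply/forallP => i; have := H (lift ord_max i).
  by rewrite ffunE liftK lift_max prev_row_rcons // ltnW.
rewrite ffunE; case: unliftP => [j|] ->; last by rewrite prev_row_rcons.
by rewrite lift_max prev_row_rcons ?Hg // ltnW.
Qed.

Section Composition.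
Variables (B : comNzRingType) (alpha beta : nat -> B).
Implicit Types (la mu : nat -> nat).

Definition skew_wt x y n la mu := \prod_(i < n)
  row_wt alpha x y (beta i.-1) (prev_row mu i) (mu i) (la i).

Lemma eq_skew_wt x y n la mu la' mu' :
  (forall i, (i < n)%N -> la i = la' i) -> (forall i, (i < n)%N -> mu i = mu' i) ->
  skew_wt x y n la mu = skew_wt x y n la' mu'.
Proof.
move=> ela emu; apply: eq_bigr => i _; rewrite ela ?emu //.
suff -> : prev_row mu i = prev_row mu' i by [].
by case: i => -[|i] //= lin; rewrite emu //; apply: ltnW.
Qed.

(** The initial value reflects the convention of [prev_row]: the row above the first one has length
    exactly [b] in all three partitions. *)
Fixpoint row_sums x y z la mu n : nat -> B :=
  if n is n'.+1 then
    next_row alpha x y z (beta n'.-1) (prev_row mu n') (prev_row la n') (mu n') (la n')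
      (row_sums x y z la mu n')
  else fun k => (k == b)%:R.

Section RowSums.
Variables (x y z : B) (la mu : nat -> nat) (n : nat).
Hypotheses (la_shape : is_shape n la) (mu_shape : is_shape n mu) (mu_la : is_sub n mu la).

Lemma prev_row_sub m : (m <= n)%N -> (prev_row mu m <= prev_row la m)%N.
Proof. by case: m => // m; apply: mu_la. Qed.

Lemma row_sums_balanced m : (m <= n)%N ->
  balanced alpha x y z (prev_row mu m) (prev_row la m) (row_sums x y z la mu m).
Proof.
elim: m => [_|m IH lmn] /=; first by split=> [k|]; lia.
have lmn' := ltnW lmn.
by apply: next_row_balanced; rewrite ?prev_row_sub ?mu_la ?la_shape ?mu_shape //; apply: IH.
Qed.

Lemma row_sums_total m : (m <= n)%N ->
  tail_sum (row_sums x y z la mu m) (prev_row la m) (prev_row mu m) = skew_wt x z m la mu.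
Proof.
elim: m => [_|m IH lmn] /=.
  by rewrite /tail_sum big_nat1 eqxx /skew_wt big_ord0.
have lmn' := ltnW lmn.
rewrite next_row_sum ?prev_row_sub ?mu_la ?la_shape ?mu_shape //.
  by rewrite IH // /skew_wt big_ord_recr.
exact: row_sums_balanced.
Qed.

Lemma prev_row_le_b m : (m <= n)%N -> (prev_row la m <= b)%N.
Proof.
elim: m => // m IH lmn /=; apply: leq_trans (IH (ltnW lmn)); exact: la_shape.
Qed.

(** The test function [phi] of the last row is what makes the induction go through, since the weight
    of the following row depends on that row and on nothing earlier in nu. *)
Lemma row_sumsE m (phi : nat -> B) : (m <= n)%N ->
  \sum_(nu : {ffun 'I_m -> 'I_b.+1} | between la mu nu)
     skew_wt x y m la (rows nu) * skew_wt y z m (rows nu) mu * phi (prev_row (rows nu) m) =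
  \sum_(prev_row mu m <= k < (prev_row la m).+1) row_sums x y z la mu m k * phi k.
Proof.
elim: m phi => [|m IH] phi lmn.
  rewrite /= big_nat1 eqxx (big_pred1 [ffun=> ord0]) /=.
    by rewrite /skew_wt !big_ord0 !mul1r.
  move=> nu; transitivity true; first by apply/forallP => -[].
  by apply/esym/eqP/ffunP => -[].
pose w k0 k := row_wt alpha x y (beta m.-1) k0 k (la m) *
  row_wt alpha y z (beta m.-1) (prev_row mu m) (mu m) k.
pose psi k0 := \sum_(mu m <= k < (la m).+1 | (k <= k0)%N) w k0 k * phi k.
(* The last row is summed first; the result depends only on the row above it and serves as the new
   test function. *)
transitivity (\sum_(nu : {ffun 'I_m -> 'I_b.+1} | between la mu nu)
     skew_wt x y m la (rows nu) * skew_wt y z m (rows nu) mu * psi (prev_row (rows nu) m)).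
  rewrite big_ffun_rcons [RHS]big_mkcond; apply: eq_bigr => g _.
  under eq_bigl do rewrite between_rcons.
  case: ifP => [_|_]; last by rewrite big_pred0.
  rewrite /= mulr_sumr.
  have lab : ((la m).+1 <= b.+1)%N by rewrite ltnS (@prev_row_le_b m.+1).
  rewrite (big_nat_widen _ _ _ _ _ lab) (big_nat_widenl _ _ _ _ _ (leq0n (mu m))) big_mkord.
  apply: eq_big => [t|t _]; first by rewrite /=; lia.
  rewrite rows_rcons_last /w /skew_wt !big_ord_recr /= rows_rcons_last prev_row_rcons //.
  rewrite -!/(skew_wt _ _ _ _ _).
  have e1 : skew_wt x y m la (rows (ffun_rcons g t)) = skew_wt x y m la (rows g).
    by apply: eq_skew_wt => // i im; rewrite rows_rcons.
  have e2 : skew_wt y z m (rows (ffun_rcons g t)) mu = skew_wt y z m (rows g) mu.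
    by apply: eq_skew_wt => // i im; rewrite rows_rcons.
  move: e1 e2; rewrite /skew_wt => -> ->; ring.
rewrite IH ?(ltnW lmn) // /psi.
under eq_bigr do rewrite mulr_sumr.
rewrite (exchange_big_dep_nat predT) //=; apply: eq_big_nat => k kb.
rewrite /next_row ifT; last by lia.
by rewrite mulr_suml; apply: eq_bigr => k0 _; rewrite !mulrA.
Qed.

Lemma skew_wt_comp :
  \sum_(nu : {ffun 'I_n -> 'I_b.+1} | between la mu nu)
     skew_wt x y n la (rows nu) * skew_wt y z n (rows nu) mu = skew_wt x z n la mu.
Proof.
rewrite -row_sums_total // /tail_sum.
have := row_sumsE (fun=> 1) (leqnn n).
under eq_bigr do rewrite mulr1; move=> ->.
by under eq_bigr do rewrite mulr1.
Qed.
End RowSums.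
End Composition.
End Shapes.

(** * The commuting matrices of a box *)

Section Dual.
Variables (B : comNzRingType).
Implicit Types (alpha beta : nat -> B) (x y z : B) (la mu : nat -> nat).

(* The same with bottom and left edges. *)
Definition row_wt' alpha x y bt q p l := \prod_(p <= j < l)
  ((if j < q then bt else x)%N - (if p < j then alpha j.-1 else y)%N).

Definition skew_wt' alpha beta x y n la mu := \prod_(i < n)
  row_wt' alpha x y (beta i) (la i.+1) (mu i) (la i).

Lemma row_wt'_geq alpha x y bt q p l : (l <= p)%N -> row_wt' alpha x y bt q p l = 1.
Proof. by move=> lp; rewrite /row_wt' big_geq. Qed.

Lemma row_wt'_over alpha x y bt q p l : (p < q <= l)%N ->
  row_wt' alpha x y bt q p l =
  (bt - y) * alpha_prod alpha bt p q.-1 * alpha_prod alpha x q.-1 l.-1.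
Proof.
case/andP=> pq ql; rewrite /row_wt' big_ltn ?(leq_trans pq ql) // pq ltnn -mulrA.
congr (_ * _); case: q l pq ql => // q [|l] //=; rewrite !ltnS => pq ql.
rewrite big_add1 /= (@big_cat_nat _ _ _ q) //=; congr (_ * _).
  by apply: eq_big_nat => j /andP[pj jq]; rewrite ltnS jq ltnS pj.
by apply: eq_big_nat => j /andP[qj jl]; rewrite ltnS ltnNge qj ltnS (leq_trans pq).
Qed.

Lemma row_wt'_free alpha x y bt q p l : (p < l)%N -> (q <= p)%N ->
  row_wt' alpha x y bt q p l = (x - y) * alpha_prod alpha x p l.-1.
Proof.
move=> pl qp; rewrite /row_wt' big_ltn // ltnn ltnNge qp.
congr (_ * _); case: l pl => // l /=; rewrite ltnS => pl.
rewrite big_add1 /=; apply: eq_big_nat => j /andP[pj jl].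
by rewrite ltnS pj ltnNge (leq_trans qp) // leqW.
Qed.

(* Where row [i+1] of the shape meets row [i], the two weights of these rows differ *)
(* by the position of the factors of the common columns.                           *)
Lemma skew_wt'E b n alpha beta x y la mu :
  is_shape b n la -> is_shape b n mu -> is_sub n mu la -> la n = 0%N ->
  skew_wt' alpha beta x y n la mu = skew_wt b alpha beta x y n la mu.
Proof.
move=> la_shape mu_shape mu_la la0.
(* Induct on the first [m] rows, with nothing below the last of them: adding a row then changes only
   the factor of the row just above it. *)
have trunc m : (m <= n)%N ->
    \prod_(i < m) row_wt' alpha x y (beta i) (if i.+1 == m then 0 else la i.+1) (mu i) (la i)
    = skew_wt b alpha beta x y m la mu; last first.
  rewrite -trunc //; apply: eq_bigr => i _.
  by case: eqP => // ->; rewrite la0.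
elim: m => [|m IH] lmn; first by rewrite /skew_wt !big_ord0.
rewrite /skew_wt !big_ord_recr /= eqxx -/(skew_wt b alpha beta x y m la mu) -IH 1?ltnW //.
have lam : (la m <= prev_row b la m)%N by apply: la_shape.
have mum : (mu m <= prev_row b mu m)%N by apply: mu_shape.
have mulam : (mu m <= la m)%N by apply: mu_la.
case: m => [|m] in lmn lam mum mulam {IH} *; rewrite /= in lam mum *.
  rewrite !big_ord0 !mul1r.
  move: mulam; rewrite leq_eqVlt => /predU1P[->|lt]; first by rewrite row_wt_geq ?row_wt'_geq.
  by rewrite row_wt'_free // row_wt_free ?lt //; ring.
rewrite !big_ord_recr /= !eqxx.
have -> : \prod_(i < m) row_wt' alpha x y (beta i)
      (if i.+1 == m.+2 then 0 else la i.+1) (mu i) (la i) =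
    \prod_(i < m) row_wt' alpha x y (beta i)
      (if i.+1 == m.+1 then 0 else la i.+1) (mu i) (la i).
  by apply: eq_bigr => i _; rewrite !eqSS (ltn_eqF (ltn_ord i)) (ltn_eqF (leqW (ltn_ord i))).
rewrite -!mulrA; congr (_ * _); rewrite ltn_eqF //.
have mulam1 : (mu m <= la m)%N by apply/mu_la/ltnW.
have [lamu|mula] := leqP (la m.+1) (mu m).
  have -> : row_wt' alpha x y (beta m) (la m.+1) (mu m) (la m) =
            row_wt' alpha x y (beta m) 0 (mu m) (la m).
    move: mulam1; rewrite leq_eqVlt => /predU1P[->|lt]; first by rewrite !row_wt'_geq.
    by rewrite !row_wt'_free.
  congr (_ * _); move: mulam; rewrite leq_eqVlt => /predU1P[->|lt].
    by rewrite row_wt_geq ?row_wt'_geq.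
  by rewrite row_wt'_free // row_wt_free ?lt //; ring.
rewrite row_wt'_over ?mula // !row_wt'_free //; try lia.
rewrite row_wt_over ?mum //.
rewrite (@alpha_prod_cat _ alpha x (mu m) (la m.+1).-1 (la m).-1); last by lia.
rewrite (@alpha_prod_cat _ alpha x (mu m.+1) (mu m) (la m.+1).-1); last by lia.
ring.
Qed.
End Dual.

Section Matrices.
Variables (a b : nat).
Notation shape := {ffun 'I_a -> 'I_b.+1}.
Implicit Types (la mu nu : shape).

Definition kmx (B : Type) (K : shape -> shape -> B) : 'M[B]_#|{: shape}| :=
  \matrix_(i, j) K (enum_val i) (enum_val j).

Lemma kmxE B (K : shape -> shape -> B) la mu :
  kmx K (enum_rank la) (enum_rank mu) = K la mu.
Proof. by rewrite mxE !enum_rankK. Qed.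

Lemma kmx_eq B (K L : shape -> shape -> B) : (forall la mu, K la mu = L la mu) -> kmx K = kmx L.
Proof. by move=> KL; apply/matrixP => i j; rewrite !mxE. Qed.

Lemma kmxP B (M : 'M[B]_#|{: shape}|) : M = kmx (fun la mu => M (enum_rank la) (enum_rank mu)).
Proof. by apply/matrixP => i j; rewrite !mxE !enum_valK. Qed.

Lemma kmx_mul (B : pzRingType) (K L : shape -> shape -> B) :
  kmx K *m kmx L = kmx (fun la mu => \sum_nu K la nu * L nu mu).
Proof.
apply/matrixP => i j; rewrite !mxE [RHS](reindex (@enum_val shape predT)) /=; last first.
  exact/onW_bij/enum_val_bij.
by apply: eq_bigr => k _; rewrite !mxE.
Qed.

Lemma kmx1 (B : pzRingType) : kmx (fun la mu => (la == mu)%:R) = 1%:M :> 'M[B]_#|{: shape}|.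
Proof. by apply/matrixP => i j; rewrite !mxE (inj_eq enum_val_inj). Qed.

Definition part nu := [forall i : 'I_a, nu i <= prev_row b (rows nu) i]%N.
Definition subshape mu la := [forall i : 'I_a, mu i <= la i]%N.

Lemma part_shape nu : part nu -> is_shape b a (rows nu).
Proof.
move=> /forallP H i ia; have := H (Ordinal ia).
by rewrite -(rowsE nu (Ordinal ia)).
Qed.

Lemma subshape_is_sub mu la : subshape mu la -> is_sub a (rows mu) (rows la).
Proof.
move=> /forallP H i ia; have := H (Ordinal ia).
by rewrite -(rowsE mu (Ordinal ia)) -(rowsE la (Ordinal ia)).
Qed.

Lemma subshape_anti mu la : subshape mu la -> subshape la mu -> mu = la.
Proof.
move=> /forallP H1 /forallP H2; apply/ffunP => i; apply/val_inj/eqP.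
by rewrite eqn_leq H1 H2.
Qed.

Lemma subshape_refl la : subshape la la.
Proof. by apply/forallP. Qed.

Lemma subshape_trans nu mu la : subshape mu nu -> subshape nu la -> subshape mu la.
Proof.
by move=> /forallP H1 /forallP H2; apply/forallP => i; apply: leq_trans (H2 i).
Qed.

(* The diagonal is 1 also at functions that are not partitions, so that kernels *)
(* compose like matrices with an identity.                                      *)
Definition skew_kernel (B : pzRingType) (W : shape -> shape -> B) la mu :=
  if la == mu then 1
  else if [&& part la, part mu & subshape mu la] then W la mu else 0.

(** At functions that are not partitions both kernels are diagonal with entries 1; between
    partitions, a nonzero product needs mu in nu in la. Only the sum over this interval has to be
    checked. *)
Lemma skew_kernel_comp (B : pzRingType) (W1 W2 W3 : shape -> shape -> B) :
  (forall la, part la -> W1 la la = 1) -> (forall la, part la -> W2 la la = 1) ->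
  (forall la mu, part la -> part mu -> subshape mu la ->
     \sum_(nu | [&& part nu, subshape mu nu & subshape nu la]) W1 la nu * W2 nu mu = W3 la mu) ->
  kmx (skew_kernel W1) *m kmx (skew_kernel W2) = kmx (skew_kernel W3).
Proof.
move=> W1r W2r W12; rewrite kmx_mul; apply: kmx_eq => la mu.
have kE W la' mu' : (forall la, part la -> W la la = 1) -> part la' -> part mu' ->
    @skew_kernel B W la' mu' = if subshape mu' la' then W la' mu' else 0.
  by move=> Wr pl pm; rewrite /skew_kernel pl pm /=; case: eqP => // ->; rewrite subshape_refl Wr.
have W3r la' : part la' -> W3 la' la' = 1.
  move=> pl; rewrite -W12 ?subshape_refl // (big_pred1 la') ?W1r ?W2r ?mulr1 // => nu /=.
  apply/and3P/eqP => [[_ H1 H2]|->]; [exact: subshape_anti | by rewrite pl subshape_refl].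
have off W la' mu' : ~~ (part la' && part mu') ->
    @skew_kernel B W la' mu' = (la' == mu')%:R.
  rewrite /skew_kernel; case: eqP => //= _; case: (part la') => //=.
  by case: (part mu').
have [pl|npl] := boolP (part la); last first.
  rewrite (bigD1 la) //= big1 => [|nu ne]; last first.
    by rewrite off ?(negPf npl) // eq_sym (negPf ne) mul0r.
  rewrite addr0 !off ?(negPf npl) //.
  by rewrite eqxx mul1r.
have [pm|npm] := boolP (part mu); last first.
  rewrite (bigD1 mu) //= big1 => [|nu ne]; last first.
    by rewrite (off W2) ?(negPf npm) ?andbF // (negPf ne) mulr0.
  by rewrite addr0 !off ?(negPf npm) ?andbF // eqxx mulr1.
rewrite kE // (bigID (fun nu => [&& part nu, subshape mu nu & subshape nu la])) /=.
rewrite [X in _ + X]big1 => [|nu].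
  rewrite addr0; case: ifP => [ml|nml].
    rewrite -W12 //; apply: eq_bigr => nu /and3P[pn mn nl].
    by rewrite !kE // mn nl.
  rewrite big1 // => nu /and3P[_ mn nl].
  by rewrite (subshape_trans mn nl) in nml.
have [pn|npn] := boolP (part nu) => /= H.
  rewrite !kE //; case: (subshape nu la) H => /=; last by rewrite mul0r.
  by rewrite andbT => /negPf ->; rewrite mulr0.
by rewrite (off W1) ?pl //= (_ : la == nu = false) ?mul0r //; apply: contraNF npn => /eqP <-.
Qed.

Definition bi_mx (B : comNzRingType) (alpha beta : nat -> B) x y :=
  kmx (skew_kernel (fun la mu => skew_wt b alpha beta x y a (rows la) (rows mu))).

Lemma betweenE la mu nu :
  between (rows la) (rows mu) nu = [&& part nu, subshape mu nu & subshape nu la].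
Proof.
apply/forallP/and3P => [H|[/forallP H1 /forallP H2 /forallP H3] i].
  by split; apply/forallP => i; have /and3P[] := H i; rewrite ?rowsE.
by rewrite H1 !rowsE H2 H3.
Qed.

Lemma skew_wt_refl (B : comNzRingType) (alpha beta : nat -> B) x y n (f : nat -> nat) :
  skew_wt b alpha beta x y n f f = 1.
Proof. by apply: big1 => i _; rewrite row_wt_geq. Qed.

Lemma skew_wt'_refl (B : comNzRingType) (alpha beta : nat -> B) x y n (f : nat -> nat) :
  skew_wt' alpha beta x y n f f = 1.
Proof. by apply: big1 => i _; rewrite row_wt'_geq. Qed.

Lemma bi_mx_mul (B : comNzRingType) (alpha beta : nat -> B) x y z :
  bi_mx alpha beta x y *m bi_mx alpha beta y z = bi_mx alpha beta x z.
Proof.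
apply: skew_kernel_comp => [la _|la _|la mu pl pm ml]; try exact: skew_wt_refl.
under eq_bigl do rewrite -betweenE.
by apply: skew_wt_comp; [exact: part_shape|exact: part_shape|exact: subshape_is_sub].
Qed.

(* The top right cell of the shape has weight [x - x]. *)
Lemma bi_mx_diag (B : comNzRingType) (alpha beta : nat -> B) x :
  bi_mx alpha beta x x = 1%:M.
Proof.
rewrite -kmx1; apply: kmx_eq => la mu; rewrite /skew_kernel.
case: eqP => //= ne; case: ifP => // /and3P[pl pm ml].
have ex : exists i, (i < a)%N && (rows mu i < rows la i)%N.
  have /existsP[i Hi] : [exists i : 'I_a, (mu i < la i)%N].
    apply: contra_notT ne; rewrite negb_exists => /forallP H.
    by apply: subshape_anti => //; apply/forallP => i; rewrite leqNgt.
  by exists i; rewrite !rowsE ltn_ord.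
(* In the topmost row that has cells, no cell has an upper neighbour: either it is the first row or
   the row above is empty. So [row_wt_free] applies and shows the factor x - x. *)
case: (ex_minnP ex) => i /andP[ia lt] imin.
rewrite /skew_wt (bigD1 (Ordinal ia)) //= row_wt_free; first by rewrite subrr mulr0 mul0r.
rewrite lt /=; have := part_shape pl ia; case: i ia lt imin => //= i ia lt imin.
move/leq_trans; apply; rewrite leqNgt; apply/negP => lt'.
by have := imin i; rewrite lt' (ltnW ia) ltnn => /(_ isT).
Qed.

Definition rot180 nu : shape := [ffun i => rev_ord (nu (rev_ord i))].

Lemma rot180K : involutive rot180.
Proof. by move=> nu; apply/ffunP => i; rewrite !ffunE !rev_ordK. Qed.

Lemma rows_rot180 nu i : (i < a)%N -> rows (rot180 nu) i = (b - rows nu (a - i.+1))%N.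
Proof.
move=> ia; rewrite -[i in LHS]/(val (Ordinal ia)) rowsE ffunE /= subSS.
by rewrite -rowsE.
Qed.

Lemma rot180_sub mu la : subshape (rot180 mu) (rot180 la) = subshape la mu.
Proof.
apply/forallP/forallP => H i; last by rewrite !ffunE /= !subSS leq_sub2l.
have := H (rev_ord i); rewrite !ffunE rev_ordK /= !subSS.
by have := ltn_ord (mu i); have := ltn_ord (la i); lia.
Qed.

Lemma rot180_part nu : part nu -> part (rot180 nu).
Proof.
move=> pn; apply/forallP => i; have := part_shape pn.
have ia := ltn_ord i; rewrite -rowsE rows_rot180 //.
case: (i : nat) ia => [|k] ka H /=; first by rewrite leq_subr.
rewrite rows_rot180 ?(ltnW ka) //; apply: leq_sub2l.
have := H (a - k.+1)%N; have -> : (a - k.+1 = (a - k.+2).+1)%N by lia.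
by apply; lia.
Qed.

Lemma rot180_partE nu : part (rot180 nu) = part nu.
Proof. by apply/idP/idP => [/rot180_part|/rot180_part //]; rewrite rot180K. Qed.

(** Rotation sends top and right edges to bottom and left ones. The edge between columns j and j+1
    goes to the edge between b-j-2 and b-j-1, and likewise for rows; hence the shifts by 2 in the
    parameters. *)
Lemma skew_wt_rot180 (B : comNzRingType) (alpha beta : nat -> B) x y la mu :
  skew_wt b (fun j => alpha (b - j.+2)%N) (fun i => beta (a - i.+2)%N) x y a
    (rows (rot180 mu)) (rows (rot180 la)) =
  skew_wt' alpha beta x y a (rows la) (rows mu).
Proof.
rewrite /skew_wt (reindex_inj rev_ord_inj) /=; apply: eq_bigr => i _.
have ia := ltn_ord i; rewrite !rows_rot180; try lia.
have -> : (a - (a - i.+1).+1 = i)%N by lia.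
have lab := rows_le la i; have mub := rows_le mu i.
rewrite /row_wt /row_wt'.
rewrite (big_nat_widen _ _ b) ?leq_subr // (big_nat_widenl _ 0) //.
rewrite [RHS](big_nat_widen _ _ b) // [RHS](big_nat_widenl _ 0) //.
rewrite !big_mkord (reindex_inj rev_ord_inj) /=.
apply: eq_big => [j|j _]; first by have := ltn_ord j; lia.
have jb := ltn_ord j.
congr (_ - _).
  case: (ltnP i.+1 a) => [i1a|ai1]; last first.
    have e : (a - i.+1 = 0)%N by lia.
    rewrite e /= rows_out // ltn0 ifN //; lia.
  have e : (a - i.+1 = (a - i.+2).+1)%N by lia.
  rewrite e /= rows_rot180; last by lia.
  have -> : (a - (a - i.+2).+1 = i.+1)%N by lia.
  have := rows_le la i.+1.
  have -> : (a - (a - i.+2).+2 = i)%N by lia.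
  by move=> ?; congr (if _ then _ else _); lia.
have -> : (b - (b - j.+1).+2 = j.-1)%N by lia.
by congr (if _ then _ else _); lia.
Qed.

(** Rotation reverses inclusions and hence the order of the two factors. Writing the weights in
    bottom-left form turns the claim into [skew_wt_comp] for the rotated shapes. *)
Lemma bi_mx_mul_rev (B : comNzRingType) (alpha beta : nat -> B) x y z :
  bi_mx alpha beta y z *m bi_mx alpha beta x y = bi_mx alpha beta x z.
Proof.
pose W u v la mu := skew_wt' alpha beta u v a (rows la) (rows mu).
have bE u v : bi_mx alpha beta u v = kmx (skew_kernel (W u v)).
  apply: kmx_eq => la mu; rewrite /skew_kernel; case: eqP => // _.
  case: ifP => // /and3P[pl pm ml]; rewrite /W (@skew_wt'E _ b) ?rows_out //.
  - exact: part_shape.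
  - exact: part_shape.
  - exact: subshape_is_sub.
rewrite !bE; apply: skew_kernel_comp => [la _|la _|la mu pl pm ml]; try exact: skew_wt'_refl.
rewrite /W -skew_wt_rot180 -(skew_wt_comp _ _ _ y).
- rewrite (reindex_inj (inv_inj rot180K)) /=.
  apply: eq_big => nu; last by rewrite -!skew_wt_rot180 rot180K mulrC.
  rewrite betweenE rot180_partE -{1}(rot180K mu) rot180_sub -{1}(rot180K la) rot180_sub.
  by rewrite [subshape nu _ && _]andbC.
- by apply: part_shape; rewrite rot180_partE.
- by apply: part_shape; rewrite rot180_partE.
- by apply: subshape_is_sub; rewrite rot180_sub.
Qed.

(** P(z, y) is the inverse of P(y, z), and P(x, z) commutes with it because both products equal P(x,
    y). *)
Lemma bi_mx_comm (B : comNzRingType) (alpha beta : nat -> B) x y z :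
  bi_mx alpha beta x z *m bi_mx alpha beta y z = bi_mx alpha beta y z *m bi_mx alpha beta x z.
Proof.
set C := bi_mx alpha beta.
have zy : C z y *m C y z = 1%:M by rewrite bi_mx_mul bi_mx_diag.
have yz : C y z *m C z y = 1%:M by rewrite bi_mx_mul bi_mx_diag.
have comm : C x z *m C z y = C z y *m C x z by rewrite bi_mx_mul bi_mx_mul_rev.
rewrite -[C x z *m C y z]mul1mx -yz -!mulmxA; congr (_ *m _).
by rewrite mulmxA -comm -mulmxA zy mulmx1.
Qed.
End Matrices.

(** * Reverse plane partitions as chains of partitions *)

Section Fillings.
Variables (a b : nat).
Notation shape := {ffun 'I_a -> 'I_b.+1}.
Notation cell := ('I_a * 'I_b)%type.
Implicit Types (la mu nu : shape) (c d : cell).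

Definition skew_cells la mu : {set cell} := [set c : cell | mu c.1 <= c.2 < la c.1]%N.

Definition aligned c d : bool :=
  [|| (c.1 == d.1) && (c.2 <= d.2) | (c.2 == d.2) && (c.1 <= d.1)]%N.

Definition supported n (D : {set cell}) (T : {ffun cell -> 'I_n.+1}) :=
  [forall c, (T c != ord0) == (c \in D)].

Definition increasing n (D : {set cell}) (T : {ffun cell -> 'I_n.+1}) :=
  [forall c in D, forall d in D, aligned c d ==> (T c <= T d)%N].

(* Reverse plane partitions with values in [1, n], extended by 0. *)
Definition filling n la mu (T : {ffun cell -> 'I_n.+1}) :=
  supported (skew_cells la mu) T && increasing (skew_cells la mu) T.

Lemma fillingP n la mu (T : {ffun cell -> 'I_n.+1}) :
  reflect ((forall c, (T c != ord0) = (c \in skew_cells la mu)) /\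
           (forall c d, c \in skew_cells la mu -> d \in skew_cells la mu ->
              aligned c d -> T c <= T d)%N)
          (filling la mu T).
Proof.
apply: (iffP andP) => [[/forallP H1 /forall_inP H2]|[H1 H2]]; split.
- by move=> c; exact: (eqP (H1 c)).
- by move=> c d cD dD cd; have /forall_inP/(_ d dD)/implyP := H2 c cD; apply.
- by apply/forallP => c; rewrite H1.
- by apply/forall_inP => c cD; apply/forall_inP => d dD; apply/implyP; apply: H2.
Qed.

Definition below_max n la (T : {ffun cell -> 'I_n.+2}) (i : 'I_a) (j : 'I_b) :=
  (j < la i)%N && (T (i, j) <= n)%N.

(** In a filling, the cells of a row with value at most [n], those of mu with value 0 included, form
    an initial segment, so a maximum recovers its length; the empty maximum gives length 0. *)
Definition level n la (T : {ffun cell -> 'I_n.+2}) : shape :=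
  [ffun i => inord (\max_(j < b | below_max la T i j) j.+1)].

Lemma part_le nu (i i' : 'I_a) : part nu -> (i <= i')%N -> (nu i' <= nu i)%N.
Proof.
move/part_shape=> H; rewrite -!rowsE; have := ltn_ord i'.
elim: (i' : nat) => [|k IH] ka; first by rewrite leqn0 => /eqP ->.
rewrite leq_eqVlt => /predU1P[-> //|]; rewrite ltnS => ik.
by apply: leq_trans (IH (ltnW ka) ik); apply: (H k.+1).
Qed.

Section Level.
Variables (n : nat) (la mu : shape) (T : {ffun cell -> 'I_n.+2}).
Hypotheses (la_part : part la) (mu_part : part mu) (mu_la : subshape mu la).
Hypothesis T_fill : filling la mu T.

Lemma below_max_down i (j j' : 'I_b) : (j' <= j)%N ->
  below_max la T i j -> below_max la T i j'.
Proof.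
move=> j'j /andP[jl Tj]; rewrite /below_max (leq_ltn_trans j'j jl) /=.
have [T0 Tm] := fillingP _ _ _ T_fill.
have [|] := boolP ((i, j') \in skew_cells la mu); last first.
  by rewrite -T0 negbK => /eqP ->.
move=> sj'; apply: leq_trans Tj; apply: Tm => //; last by rewrite /aligned eqxx j'j.
by move: sj'; rewrite !inE /= jl andbT => /andP[/leq_trans -> //].
Qed.

Lemma below_max_up (i i' : 'I_a) (j : 'I_b) : (i <= i')%N ->
  below_max la T i' j -> below_max la T i j.
Proof.
move=> ii' /andP[jl Tj]; have jl' := leq_trans jl (part_le la_part ii').
rewrite /below_max jl' /=.
have [T0 Tm] := fillingP _ _ _ T_fill.
have [|] := boolP ((i, j) \in skew_cells la mu); last first.
  by rewrite -T0 negbK => /eqP ->.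
move=> sj; apply: leq_trans Tj; apply: Tm => //; last by rewrite /aligned eqxx ii' orbT.
move: sj; rewrite !inE /= jl andbT => /andP[+ _]; apply: leq_trans.
exact: part_le mu_part ii'.
Qed.

Lemma level_gt i (j : 'I_b) : (j < level la T i)%N = below_max la T i j.
Proof.
rewrite ffunE inordK; last first.
  by rewrite ltnS; apply/bigmax_leqP => k _; apply: ltn_ord.
apply/idP/idP => [|jT]; last exact: (bigmax_sup j).
apply: contraLR => jT; rewrite -leqNgt; apply/bigmax_leqP => k kT.
by rewrite ltnNge; apply: contra jT => jk; apply: below_max_down kT.
Qed.

Lemma mem_skew_level c : (c \in skew_cells la (level la T)) = (T c == ord_max).
Proof.
case: c => i j; rewrite inE /= leqNgt level_gt /below_max.
have e : (T (i, j) == ord_max) = ~~ (T (i, j) <= n)%N.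
  by rewrite -ltnNge -val_eqE /= eqn_leq leq_ord.
rewrite e; have [jl|jl] := ltnP j (la i); rewrite ?andbT ?andbF //=.
have [T0 _] := fillingP _ _ _ T_fill.
apply/esym/negPn; have /negbFE/eqP -> // : (T (i, j) != ord0) = false.
by rewrite T0 inE /= [(_ < la i)%N]ltnNge jl andbF.
Qed.

Lemma leq_lt_nat m k : (forall j : 'I_b, j < m -> j < k)%N -> (m <= b)%N -> (m <= k)%N.
Proof.
case: m => // m H mb; exact: (H (Ordinal mb)).
Qed.

Lemma level_sub : subshape (level la T) la.
Proof.
apply/forallP => i; apply: leq_lt_nat => [j|]; last exact: leq_ord.
by rewrite level_gt => /andP[].
Qed.

Lemma sub_level : subshape mu (level la T).
Proof.
apply/forallP => i; apply: leq_lt_nat => [j jm|]; last exact: leq_ord.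
rewrite level_gt /below_max (leq_trans jm) ?(forallP mu_la) //=.
have [T0 _] := fillingP _ _ _ T_fill.
have /negbFE/eqP -> // : (T (i, j) != ord0) = false.
by rewrite T0 inE /= leqNgt jm.
Qed.

Lemma level_part : part (level la T).
Proof.
apply/forallP => -[[|k] ka]; first exact: leq_ord.
rewrite [prev_row _ _ _](rowsE _ (Ordinal (ltnW ka))).
apply: leq_lt_nat => [j|]; last exact: leq_ord.
by rewrite !level_gt; apply: below_max_up; rewrite /= leqnSn.
Qed.
End Level.

Section Glue.
Variables (n : nat) (la nu mu : shape).
Hypotheses (la_part : part la) (nu_part : part nu) (mu_part : part mu).
Hypotheses (mu_nu : subshape mu nu) (nu_la : subshape nu la).

Definition glue (T : {ffun cell -> 'I_n.+1}) : {ffun cell -> 'I_n.+2} :=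
  [ffun c => if c \in skew_cells la nu then ord_max else widen_ord (leqnSn n.+1) (T c)].

Definition unglue (T : {ffun cell -> 'I_n.+2}) : {ffun cell -> 'I_n.+1} :=
  [ffun c => if c \in skew_cells la nu then ord0 else inord (T c)].

Lemma skew_cat c : (c \in skew_cells la mu) = (c \in skew_cells la nu) || (c \in skew_cells nu mu).
Proof.
rewrite !inE; have := forallP mu_nu c.1; have := forallP nu_la c.1.
by clear la_part nu_part mu_part; lia.
Qed.

Lemma skew_disj c : c \in skew_cells la nu -> (c \in skew_cells nu mu) = false.
Proof. by clear -c; rewrite !inE; lia. Qed.

Lemma glueK T : filling la mu T -> level la T = nu -> glue (unglue T) = T.
Proof.
move=> Tf Tnu; have mu_la := subshape_trans mu_nu nu_la.
apply/ffunP => c; rewrite !ffunE -Tnu (mem_skew_level Tf).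
case: eqP => [-> //|/eqP ne]; apply/val_inj; rewrite /= inordK //.
by rewrite ltn_neqAle -ltnS ltn_ord andbT.
Qed.

Lemma glue_max T c : (glue T c == ord_max) = (c \in skew_cells la nu).
Proof.
rewrite ffunE; case: ifP => _; first exact: eqxx.
by rewrite -val_eqE /= ltn_eqF.
Qed.

Lemma glue_level T : filling la mu (glue T) -> level la (glue T) = nu.
Proof.
move=> Tf; apply/ffunP => i; apply/val_inj/eqP; rewrite eqn_leq.
have gt (j : 'I_b) : (j < level la (glue T) i)%N = (j < nu i)%N.
  rewrite (level_gt Tf) /below_max.
  have := glue_max T (i, j); rewrite -val_eqE /= inE /=.
  have := forallP nu_la i; have := leq_ord (glue T (i, j)).
  by move: (nat_of_ord (glue T (i, j))) => t; lia.
by apply/andP; split; apply: leq_lt_nat => [j|]; rewrite ?gt // leq_ord.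
Qed.

Lemma unglueK T : supported (skew_cells nu mu) T -> unglue (glue T) = T.
Proof.
move=> /forallP T0; apply/ffunP => c; rewrite !ffunE; case: ifP => cs.
  by have := T0 c; rewrite skew_disj // eqbF_neg negbK => /eqP.
by apply/val_inj; rewrite cs /= inordK /= ?ltn_ord.
Qed.

Lemma skew_closed c d :
  aligned c d -> c \in skew_cells la mu -> d \in skew_cells nu mu -> c \in skew_cells nu mu.
Proof.
move=> cd; rewrite !inE => /andP[-> _] /andP[_ dn] /=.
case/orP: cd => /andP[/eqP e le]; first by rewrite e (leq_ltn_trans le).
by rewrite e (leq_trans dn) // part_le.
Qed.

(** The left-hand side is the condition that [reindex_onto] produces in [fill_sumS]; its last clause
    forces [T] to vanish on la/nu. *)
Lemma glue_filling T :
  [&& filling la mu (glue T), level la (glue T) == nu & unglue (glue T) == T] =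
  filling nu mu T.
Proof.
apply/and3P/idP => [[Tf _ /eqP Tk]|Tf].
  have [T0 Tm] := fillingP _ _ _ Tf; apply/fillingP; split=> [c|c d cs ds cd].
    have := T0 c; rewrite skew_cat; have [cs _|cs] := boolP (c \in skew_cells la nu).
      by rewrite skew_disj // -Tk ffunE cs eqxx.
    by rewrite ffunE (negPf cs) -!val_eqE.
  have := Tm c d; rewrite !skew_cat cs ds !orbT => /(_ isT isT cd).
  rewrite !ffunE; case: ifP => [/skew_disj|_]; first by rewrite cs.
  by case: ifP => [/skew_disj|_ //]; rewrite ds.
have Tf' : filling la mu (glue T); last first.
  by split=> //; [apply/eqP/glue_level|case/andP: Tf => Ts _; rewrite unglueK].
have [T0 Tm] := fillingP _ _ _ Tf; apply/fillingP; split=> [c|c d cs ds cd].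
  by rewrite skew_cat -T0 ffunE; case: ifP => //= _; rewrite -val_eqE.
rewrite (ffunE _ d); case: ifP => [_|dla]; first exact: leq_ord.
have dnu : d \in skew_cells nu mu by move: ds; rewrite skew_cat dla.
have cnu := skew_closed cd cs dnu.
by rewrite ffunE ifF; [apply: Tm|apply: contraTF cnu => /skew_disj ->].
Qed.
End Glue.

Section Weights.
Variables (B : comNzRingType) (w : cell -> {set cell} -> B -> B) (x : nat -> B).

Definition fill_sum n la mu := \sum_(T : {ffun cell -> 'I_n.+1} | filling la mu T)
  \prod_(c in skew_cells la mu) w c [set d | T d == T c] (x (T c).-1).

(* The weight [w c K u] of a cell [c] depends on the set [K] of the cells having the *)
(* same value.                                                                     *)
Definition level_wt u la mu := \prod_(c in skew_cells la mu) w c (skew_cells la mu) u.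

Lemma skew_refl la : skew_cells la la = set0.
Proof. by apply/setP => c; rewrite !inE; lia. Qed.

Lemma level_wt_refl u la : level_wt u la la = 1.
Proof. by rewrite /level_wt skew_refl big_set0. Qed.

Lemma fill_sum0 la mu : subshape mu la -> fill_sum 0 la mu = (la == mu)%:R.
Proof.
move=> ml; have [->|ne] := eqVneq la mu.
  rewrite /fill_sum (big_pred1 [ffun=> ord0]) ?skew_refl ?big_set0 // => T /=.
  have -> : T == [ffun=> ord0] by apply/eqP/ffunP => c; rewrite ffunE ord1.
  by apply/fillingP; split=> [c|c d]; rewrite skew_refl inE // ord1.
rewrite /fill_sum big_pred0 // => T; apply/negP => /fillingP[T0 _].
case/eqP: ne; apply: subshape_anti => //; apply/forallP => i.
apply: leq_lt_nat => [j jla|]; last exact: leq_ord.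
have := T0 (i, j); rewrite ord1 /= inE /= jla andbT.
by move/esym/negbT; rewrite -ltnNge.
Qed.

(** The cells with the largest value form la/nu for nu = [level la T]. Cells of equal value lie on
    the same side of this cut, so the weight factors. *)
Lemma fill_sumS n la mu : part la -> part mu -> subshape mu la ->
  fill_sum n.+1 la mu =
  \sum_(nu | [&& part nu, subshape mu nu & subshape nu la]) level_wt (x n) la nu * fill_sum n nu mu.
Proof.
move=> pl pm ml; rewrite {1}/fill_sum.
rewrite (partition_big (level la) (fun nu => [&& part nu, subshape mu nu & subshape nu la])) /=.
  apply: eq_bigr => nu /and3P[pn mn nl].
  rewrite (reindex_onto (glue la nu) (unglue la nu)) /=; last first.
    by move=> T /andP[Tf /eqP Tn]; apply: glueK Tf Tn.
  rewrite /fill_sum mulr_sumr; apply: eq_big => T.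
    by rewrite -andbA (glue_filling pl).
  rewrite -andbA (glue_filling pl) // => Tf.
  have [T0 _] := fillingP _ _ _ Tf.
  rewrite (bigID (mem (skew_cells la nu))) /=; congr (_ * _).
    apply: eq_big => [c|c /andP[_ cs]].
      by rewrite (skew_cat mn nl); case: (c \in skew_cells la nu); rewrite ?andbF.
    have e d : (glue la nu T d == glue la nu T c) = (d \in skew_cells la nu).
      by rewrite [glue la nu T c]ffunE cs glue_max.
    rewrite (_ : [set d | _] = skew_cells la nu); last by apply/setP => d; rewrite inE e.
    by rewrite ffunE cs.
  apply: eq_big => [c|c /andP[cs ncs]].
    rewrite (skew_cat mn nl); have := @skew_disj la nu mu c.
    by case: (c \in skew_cells la nu) => //= [/(_ isT) -> //|_]; rewrite andbT.
  have csn : c \in skew_cells nu mu by move: cs; rewrite (skew_cat mn nl) (negPf ncs).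
  have gc : glue la nu T c = widen_ord (leqnSn n.+1) (T c) by rewrite ffunE (negPf ncs).
  rewrite gc; congr w; apply/setP => d; rewrite !inE ffunE.
  (* A cell of la/nu belongs to neither set: after gluing it holds the maximum, and before it holds
     0, while [T c] is nonzero. *)
  case: ifP => [/skew_disj dn|_]; last by rewrite -!val_eqE.
  rewrite -val_eqE /= gtn_eqF //; apply/esym/eqP => e.
  by have := T0 d; rewrite e T0 csn (dn mu).
by move=> T Tf; rewrite (level_part pl pm Tf) (sub_level ml Tf) (level_sub Tf).
Qed.

Definition level_mx u := kmx (skew_kernel (level_wt u)).

Fixpoint level_prod n : 'M[B]_#|{: shape}| :=
  if n is n'.+1 then level_mx (x n') *m level_prod n' else 1%:M.

Lemma level_prodE n la mu : part la -> part mu ->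
  level_prod n (enum_rank la) (enum_rank mu) = if subshape mu la then fill_sum n la mu else 0.
Proof.
elim: n la => [|n IH] la pl pm /=.
  rewrite -kmx1 kmxE; case: ifP => ml; first by rewrite fill_sum0.
  by case: eqP ml => // ->; rewrite subshape_refl.
rewrite [level_prod n]kmxP kmx_mul kmxE.
pose Q nu := [&& part nu, subshape mu nu & subshape nu la].
rewrite (bigID Q) /= [X in _ + X]big1 ?addr0 => [|nu nQ]; last first.
  have [pn|npn] := boolP (part nu); last first.
    rewrite /skew_kernel (negPf npn) andbF.
    by case: eqP npn => [<-|_]; rewrite ?pl ?mul0r.
  rewrite IH //; have [mn|_] := boolP (subshape mu nu); last by rewrite mulr0.
  have nnl : ~~ subshape nu la by move: nQ; rewrite /Q pn mn.
  rewrite /skew_kernel (negPf nnl) !andbF.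
  by case: eqP nnl => [->|_]; rewrite ?subshape_refl ?mul0r.
case: ifP => [ml|nml].
  rewrite fill_sumS //; apply: eq_bigr => nu /and3P[pn mn nl].
  rewrite IH // mn /skew_kernel pl pn nl.
  by case: eqP => // ->; rewrite level_wt_refl.
rewrite big1 // => nu /and3P[_ mn nl].
by rewrite (subshape_trans mn nl) in nml.
Qed.
End Weights.
End Fillings.

(** * One-variable weights of both sides of the identity *)

Section CellWeights.
Variables (a b : nat) (B : comNzRingType) (alpha beta : nat -> B).
Notation shape := {ffun 'I_a -> 'I_b.+1}.
Notation cell := ('I_a * 'I_b)%type.
Implicit Types (la mu nu : shape) (c d : cell) (K : {set cell}).

Definition has_up K c := [exists d in K, (d.1.+1 == c.1 :> nat) && (d.2 == c.2)].
Definition has_down K c := [exists d in K, (d.1 == c.1.+1 :> nat) && (d.2 == c.2)].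
Definition has_left K c := [exists d in K, (d.1 == c.1) && (d.2.+1 == c.2 :> nat)].
Definition has_right K c := [exists d in K, (d.1 == c.1) && (d.2 == c.2.+1 :> nat)].

(** The two summands are the marked and the unmarked contribution of the cell. *)
Definition cell_wt_ur c K x : B :=
  (if has_right K c then - alpha c.2 else 0) + (if has_up K c then beta c.1.-1 else x).

(** The same for the transposed filling with parameters -beta, -alpha, seen on la/mu: right and
    upper neighbours become lower and left ones. *)
Definition cell_wt_dl c K x : B :=
  (if has_down K c then beta c.1 else 0) + (if has_left K c then - alpha c.2.-1 else x).

Lemma prod_skew (f : nat -> nat -> B) la mu :
  \prod_(c in skew_cells la mu) f c.1 c.2 =
  \prod_(i < a) \prod_(rows mu i <= j < rows la i) f i j.
Proof.
pose F (i : 'I_a) (j : 'I_b) := if (i, j) \in skew_cells la mu then f i j else 1.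
rewrite big_mkcond; transitivity (\prod_(c : cell) F c.1 c.2); first by apply: eq_bigr => -[].
rewrite -(pair_bigA _ F); apply: eq_bigr => i _.
rewrite (big_nat_widen _ _ b) ?rows_le // (big_nat_widenl _ 0) // big_mkord.
rewrite [RHS]big_mkcond; apply: eq_bigr => j _ /=.
by rewrite /F inE /= !rowsE andbC.
Qed.

Lemma has_upE la mu c : part la -> c \in skew_cells la mu ->
  has_up (skew_cells la mu) c = (prev_row b (rows mu) c.1 <= c.2)%N.
Proof.
case: c => -[i ia] j pl; rewrite inE /= => /andP[mj jl].
apply/exists_inP/idP => [[[i' j']]|].
  rewrite inE /= => /andP[mj' jl'] /andP[/eqP e /eqP ej].
  by rewrite -e /= -ej rowsE.
case: i ia mj jl => [|i] ia mj jl /=; first by rewrite leqNgt ltn_ord.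
pose i' := Ordinal (ltnW ia); rewrite -[X in rows mu X]/(nat_of_ord i') rowsE => mj'.
exists (i', j); last by rewrite /= !eqxx.
by rewrite inE /= mj' (leq_trans jl) // part_le //=.
Qed.

Lemma has_rightE la mu c : c \in skew_cells la mu ->
  has_right (skew_cells la mu) c = (c.2.+1 < la c.1)%N.
Proof.
case: c => i j; rewrite inE /= => /andP[mj jl].
apply/exists_inP/idP => [[[i' j']]|jl'].
  by rewrite inE /= => /andP[_ jl'] /andP[/eqP <- /eqP <-].
exists (i, Ordinal (leq_trans jl' (leq_ord _))); last by rewrite /= !eqxx.
by rewrite inE /= jl' (leq_trans mj).
Qed.

Lemma has_downE la mu c : part mu -> c \in skew_cells la mu ->
  has_down (skew_cells la mu) c = (c.2 < rows la c.1.+1)%N.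
Proof.
case: c => i j pm; rewrite inE /= => /andP[mj jl].
apply/exists_inP/idP => [[[i' j']]|jl'].
  rewrite inE /= => /andP[mj' jl'] /andP[/eqP e /eqP ej].
  by rewrite -e -ej rowsE.
have ia : (i.+1 < a)%N by rewrite ltnNge; apply: contraL jl' => ai; rewrite rows_out.
pose i' := Ordinal ia; exists (i', j); last by rewrite /= !eqxx.
rewrite inE /= -[X in (_ < X)%N](rowsE la i') jl' andbT.
by apply: leq_trans mj; apply: part_le => //=.
Qed.

Lemma has_leftE la mu c : c \in skew_cells la mu ->
  has_left (skew_cells la mu) c = (mu c.1 < c.2)%N.
Proof.
case: c => i j; rewrite inE /= => /andP[mj jl].
apply/exists_inP/idP => [[[i' j']]|mj'].
  by rewrite inE /= => /andP[mj' _] /andP[/eqP <- /eqP <-].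
have jb : (j.-1 < b)%N by apply: leq_ltn_trans (ltn_ord j); exact: leq_pred.
exists (i, Ordinal jb); last by rewrite /= eqxx prednK ?eqxx // (leq_ltn_trans (leq0n _) mj').
by rewrite inE /=; lia.
Qed.

(** A cell without a right neighbour cannot be marked, which amounts to the label 0 on the right
    boundary. *)
Lemma level_mx_ur x : level_mx cell_wt_ur x = bi_mx a b alpha beta x 0.
Proof.
apply: kmx_eq => la mu; rewrite /skew_kernel; case: eqP => // _.
case: ifP => // /and3P[pl pm ml].
transitivity (\prod_(c in skew_cells la mu)
   ((if (prev_row b (rows mu) c.1 <= c.2)%N then beta c.1.-1 else x) -
    (if (c.2.+1 < rows la c.1)%N then alpha c.2 else 0))).
  apply: eq_bigr => c cs; rewrite /cell_wt_ur has_upE // has_rightE // rowsE addrC.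
  by congr (_ + _); case: ifP; rewrite ?oppr0.
exact: (prod_skew (fun i j => (if (prev_row b (rows mu) i <= j)%N then beta i.-1 else x) -
    (if (j.+1 < rows la i)%N then alpha j else 0))).
Qed.

(** In bottom-left form the boundary labels are 0 below and -x on the left; [skew_wt'E] passes to
    the top-right form. *)
Lemma level_mx_dl x : level_mx cell_wt_dl x = bi_mx a b alpha beta 0 (- x).
Proof.
apply: kmx_eq => la mu; rewrite /skew_kernel; case: eqP => // _.
case: ifP => // /and3P[pl pm ml].
rewrite -skew_wt'E ?rows_out //; try exact: part_shape; last exact: subshape_is_sub.
transitivity (\prod_(c in skew_cells la mu)
   ((if (c.2 < rows la c.1.+1)%N then beta c.1 else 0) -
    (if (rows mu c.1 < c.2)%N then alpha c.2.-1 else - x))).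
  apply: eq_bigr => c cs; rewrite /cell_wt_dl has_downE // has_leftE // rowsE.
  by congr (_ + _); case: ifP; rewrite ?opprK.
exact: (prod_skew (fun i j => (if (j < rows la i.+1)%N then beta i else 0) -
    (if (rows mu i < j)%N then alpha j.-1 else - x))).
Qed.
End CellWeights.

Section CellSums.
Variables (C K : finType) (pos : K -> C).
Hypothesis pos_inj : injective pos.

Definition extend0 n (T : {ffun K -> 'I_n}) : {ffun C -> 'I_n.+1} :=
  [ffun c => if [pick k | pos k == c] is Some k then lift ord0 (T k) else ord0].

Lemma extend0_pos n (T : {ffun K -> 'I_n}) k : extend0 T (pos k) = lift ord0 (T k).
Proof.
by rewrite ffunE; case: pickP => [k' /eqP/pos_inj -> //|/(_ k)]; rewrite eqxx.
Qed.

Lemma extend0_neq0 n (T : {ffun K -> 'I_n}) c :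
  (extend0 T c != ord0) = (c \in pos @: [set: K]).
Proof.
apply/idP/imsetP => [|[k _ ->]]; last by rewrite extend0_pos.
by rewrite ffunE; case: pickP => [k /eqP <- _|_]; [exists k|rewrite eqxx].
Qed.

Lemma extend0_inj n : injective (@extend0 n).
Proof.
move=> T T' TT'; apply/ffunP => k; apply: (@lift_inj _ ord0).
by rewrite -!extend0_pos TT'.
Qed.

Lemma extend0_surj n (T' : {ffun C -> 'I_n.+1}) :
  (forall c, (T' c != ord0) = (c \in pos @: [set: K])) -> exists T, T' = extend0 T.
Proof.
move=> T'0; have lt k : ((T' (pos k)).-1 < n)%N.
  have : T' (pos k) != ord0 by rewrite T'0 imset_f ?inE.
  by rewrite -val_eqE /=; have := ltn_ord (T' (pos k)); lia.
exists [ffun k => Ordinal (lt k)]; apply/ffunP => c.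
have := T'0 c; case: (boolP (c \in _)) => [/imsetP[k _ ->] nz|nc].
  rewrite extend0_pos ffunE; apply/val_inj; rewrite /= /bump /= add1n prednK //.
  by rewrite lt0n -val_eqE in nz *.
move/negbFE/eqP => ->; apply/esym/eqP.
by rewrite -[_ == _]negbK extend0_neq0.
Qed.

Lemma sum_extend0 (B : nmodType) n (P : pred {ffun K -> 'I_n}) (P' : pred {ffun C -> 'I_n.+1})
    (F : {ffun K -> 'I_n} -> B) (F' : {ffun C -> 'I_n.+1} -> B) :
  (forall T', P' T' -> forall c, (T' c != ord0) = (c \in pos @: [set: K])) ->
  (forall T, P' (extend0 T) = P T) ->
  (forall T, P T -> F T = F' (extend0 T)) ->
  \sum_(T | P T) F T = \sum_(T' | P' T') F' T'.
Proof.
move=> P'0 P'P FF'.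
transitivity (\sum_(T' in @extend0 n @: [set T | P T]) F' T').
  rewrite big_imset /=; last by move=> ? ? _ _; apply: extend0_inj.
  by apply: eq_big => T; [rewrite inE|apply: FF'].
apply: eq_bigl => T'; apply/imsetP/idP => [[T] |P'T'].
  by rewrite inE => PT ->; rewrite P'P.
have [T e] := extend0_surj (P'0 _ P'T').
by exists T => //; rewrite inE -P'P -e.
Qed.
End CellSums.

(** * Dual Grothendieck polynomials as matrix entries *)

(** Expanding the product of sums chooses the set of marked cells; a set with a cell that may not be
    marked contributes a zero factor. *)
Lemma sum_marks (B : comPzRingType) (K S : finType) (P : pred S) (er : S -> pred K)
    (wm : K -> B) (wu : S -> K -> B) :
  \sum_(TM : S * {set K} | P TM.1 && [forall c in TM.2, er TM.1 c])
     \prod_c (if c \in TM.2 then wm c else wu TM.1 c) =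
  \sum_(T | P T) \prod_c ((if er T c then wm c else 0) + wu T c).
Proof.
rewrite -(pair_big_dep P (fun T (M : {set K}) => [forall c in M, er T c])
  (fun T (M : {set K}) => \prod_c (if c \in M then wm c else wu T c))) /=.
apply: eq_bigr => T _; rewrite bigA_distr.
rewrite [RHS](bigID (fun M : {set K} => [forall c in M, er T c])) /=.
rewrite [X in _ + X]big1 ?addr0 => [|M].
  apply: eq_bigr => M /forall_inP H; apply: eq_bigr => c _.
  by case: ifP => // /H ->.
move=> /forall_inPn[c cM /negPf ner].
by rewrite (bigD1 c) //= cM ner mul0r.
Qed.

Section Reindex.
Variables (a b n : nat) (B : comNzRingType) (K : finType) (pos : K -> 'I_a * 'I_b).
Variables (la mu : {ffun 'I_a -> 'I_b.+1}).
Hypotheses (pos_inj : injective pos) (pos_im : pos @: [set: K] = skew_cells la mu).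

Definition equal_cells (T : {ffun K -> 'I_n}) k : {set 'I_a * 'I_b} :=
  [set d | extend0 pos T d == extend0 pos T (pos k)].

Lemma exists_equal_cells (T : {ffun K -> 'I_n}) k (Q : pred ('I_a * 'I_b)) :
  [exists d in equal_cells T k, Q d] = [exists d, Q (pos d) && (T d == T k)].
Proof.
apply/exists_inP/existsP => [[d]|[d /andP[Qd /eqP Td]]]; last first.
  by exists (pos d); rewrite // inE !extend0_pos // Td.
rewrite inE => /eqP Td Qd.
have : d \in pos @: [set: K].
  by rewrite -(extend0_neq0 pos_inj T) Td extend0_pos // -val_eqE.
case/imsetP => d' _ ed; exists d'; rewrite -ed Qd.
by move: Td; rewrite ed !extend0_pos // => /(@lift_inj _ ord0) ->; rewrite /= eqxx.
Qed.

Lemma sum_filling (w : 'I_a * 'I_b -> {set 'I_a * 'I_b} -> B -> B) (x : nat -> B)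
    (P : pred {ffun K -> 'I_n}) (F : {ffun K -> 'I_n} -> K -> B) :
  (forall T, P T = [forall c, forall d, aligned (pos c) (pos d) ==> (T c <= T d)%N]) ->
  (forall T k, F T k = w (pos k) (equal_cells T k) (x (T k))) ->
  \sum_(T | P T) \prod_k F T k = fill_sum w x n la mu.
Proof.
move=> PE FE; apply: (sum_extend0 pos_inj) => [T' /fillingP[T0 _] c|T|T _].
- by rewrite pos_im T0.
- rewrite PE; apply/fillingP/forallP => [[_ Tm] c|Tm].
    apply/forallP => d; apply/implyP => cd.
    by have := Tm (pos c) (pos d); rewrite -pos_im !imset_f ?inE // !extend0_pos //; apply.
  split=> [c|c d]; first by rewrite -pos_im extend0_neq0.
  rewrite -pos_im => /imsetP[k _ ->] /imsetP[l _ ->] kl; rewrite !extend0_pos //.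
  by have /forallP/(_ l)/implyP/(_ kl) := Tm k.
rewrite -pos_im big_imset /=; last by move=> ? ? _ _; apply: pos_inj.
apply: eq_big => [k|k _]; first by rewrite inE.
by rewrite FE; congr (w _ _ (x _)); rewrite extend0_pos // lift0.
Qed.
End Reindex.

Section Partitions.
Implicit Types (s la mu : seq nat).

Lemma part_nth_le s i j : is_part s -> (i <= j)%N -> (nth 0 s j <= nth 0 s i)%N.
Proof.
case/andP=> ss _ ij; have [js|js] := ltnP j (size s); last by rewrite (nth_default _ js).
apply: (sorted_leq_nth _ _ 0%N ss) => //; rewrite ?inE ?(leq_ltn_trans ij) //.
  by move=> x y z /= xy yz; apply: leq_trans xy.
by move=> x /=.
Qed.

Lemma part_nth_head s i : is_part s -> (nth 0 s i <= head 0 s)%N.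
Proof. by move=> sp; rewrite -nth0 part_nth_le. Qed.

Lemma nth_conj_part s i j : is_part s -> (i < nth 0 (conj_part s) j)%N = (j < nth 0 s i)%N.
Proof.
move=> sp; rewrite /conj_part; have [js|js] := ltnP j (head 0%N s); last first.
  rewrite nth_default ?size_mkseq // ltn0; apply/esym/negbTE; rewrite -leqNgt.
  by apply: leq_trans js; apply: part_nth_head.
rewrite nth_mkseq //; have {sp js} : sorted geq s by case/andP: sp.
elim: s i => [|x s IH] i /=; first by rewrite nth_nil.
move=> xs; have ss := path_sorted xs.
have /allP xmax : all (geq x) s.
  by apply: order_path_min xs => u v t /= uv vt; apply: leq_trans uv.
have nmax k : (nth 0 s k <= x)%N.
  have [ks|ks] := ltnP k (size s); last by rewrite nth_default.
  by have := xmax _ (mem_nth 0%N ks).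
have [jx|xj] := ltnP j x; first by case: i => [|i] /=; rewrite ?jx // add1n ltnS IH.
have -> : count (ltn j) s = 0%N.
  apply/eqP; rewrite eqn0Ngt -has_count; apply/hasPn => k /xmax /= kx.
  by rewrite -leqNgt (leq_trans kx).
by case: i => [|i] /=; apply/esym/negbTE; rewrite -leqNgt // (leq_trans (nmax i)).
Qed.

Lemma size_conj_part s : size (conj_part s) = head 0%N s.
Proof. by rewrite size_mkseq. Qed.

Lemma head_conj_part s : is_part s -> head 0%N (conj_part s) = size s.
Proof.
case: s => [//|x s] /andP[_]; rewrite inE negb_or => /andP[x0 s0].
rewrite /conj_part /mkseq /=; case: x x0 => //= x _; congr _.+1.
by apply/eqP; rewrite -all_count; apply/allP => k ks /=; rewrite lt0n; apply: contraNneq s0 => <-.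
Qed.

Section DualGroth.
Variables (R : comNzRingType) (alpha beta : nat -> R).
Variables (la mu : seq nat).
Hypotheses (la_part : is_part la) (mu_part : is_part mu) (mu_la : subpart mu la).
Notation a := (size la).
Notation b := (head 0%N la).

Definition shape_of s : {ffun 'I_a -> 'I_b.+1} := [ffun i : 'I_a => inord (nth 0%N s i)].

Lemma shape_ofE s i : subpart s la -> shape_of s i = nth 0%N s i :> nat.
Proof.
by move=> sla; rewrite ffunE inordK // ltnS (leq_trans (sla i)) ?part_nth_head.
Qed.

Lemma shape_of_part s : is_part s -> subpart s la -> part (shape_of s).
Proof.
move=> sp sla; apply/forallP => -[[|i] ia]; first exact: leq_ord.
rewrite [prev_row _ _ _](rowsE _ (Ordinal (ltnW ia))) !shape_ofE //.
exact: part_nth_le.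
Qed.

Lemma shape_of_sub : subshape (shape_of mu) (shape_of la).
Proof. by apply/forallP => i; rewrite !shape_ofE. Qed.

Definition var n k : {mpoly R[n]} := if insub k is Some i then 'X_i else 0.

Lemma varE n (i : 'I_n) : var n i = 'X_i.
Proof. by rewrite /var valK. Qed.

Lemma dual_grothE n : dual_groth la mu alpha beta n =
  level_prod (cell_wt_ur (@mpolyC n R \o alpha) (@mpolyC n R \o beta)) (var n) n
    (enum_rank (shape_of la)) (enum_rank (shape_of mu)).
Proof.
rewrite level_prodE ?shape_of_part // shape_of_sub.
rewrite -(@sum_filling _ _ n _ (skew_cell la mu) val _ _ val_inj _ _ _ (@is_rpp la mu n)
  (fun T c => (if eq_right T c then (- alpha (ccol c))%:MP else 0) +
     (if eq_above T c then (beta (crow c).-1)%:MP else 'X_(T c)))) //.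
- exact: sum_marks.
- apply/setP => c; rewrite inE !shape_ofE //; apply/imsetP/idP => [[k _ ->]|cs].
    exact: (valP k).
  by exists (Sub c cs).
- move=> T c; rewrite varE /cell_wt_ur /has_right /has_up !exists_equal_cells; try exact: val_inj.
  rewrite mpolyCN; congr (_ + _).
    by congr (if _ then _ else _); apply: eq_existsb => d; rewrite andbA.
  by congr (if _ then _ else _); apply: eq_existsb => d; rewrite andbA.
Qed.

Let conj_cell_pos (c : skew_cell (conj_part la) (conj_part mu)) : 'I_a * 'I_b :=
  (cast_ord (head_conj_part la_part) (val c).2, cast_ord (size_conj_part la) (val c).1).

Let conj_cell_pos_inj : injective conj_cell_pos.
Proof.
move=> c d [/val_inj e2 /val_inj e1]; apply/val_inj.
by rewrite [val c]surjective_pairing [val d]surjective_pairing e1 e2.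
Qed.

Lemma dual_groth_conjE n :
  dual_groth (conj_part la) (conj_part mu) (fun i => - beta i) (fun i => - alpha i) n =
  level_prod (cell_wt_dl (@mpolyC n R \o alpha) (@mpolyC n R \o beta)) (var n) n
    (enum_rank (shape_of la)) (enum_rank (shape_of mu)).
Proof.
rewrite level_prodE ?shape_of_part // shape_of_sub.
rewrite -(@sum_filling _ _ n _ _ conj_cell_pos _ _ conj_cell_pos_inj _ _ _
  (@is_rpp (conj_part la) (conj_part mu) n)
  (fun T c => (if eq_right T c then (- - beta (ccol c))%:MP else 0) +
     (if eq_above T c then (- alpha (crow c).-1)%:MP else 'X_(T c)))) //.
- exact: sum_marks.
- apply/setP => c; rewrite inE !shape_ofE //; apply/imsetP/idP => [[k _ ->]|cs] /=.
    rewrite leqNgt -(nth_conj_part _ _ mu_part) -(nth_conj_part _ _ la_part).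
    by rewrite -leqNgt; exact: (valP k).
  pose c' := (cast_ord (esym (size_conj_part la)) c.2,
              cast_ord (esym (head_conj_part la_part)) c.1).
  have c's : (nth 0 (conj_part mu) c'.1 <= c'.2 < nth 0 (conj_part la) c'.1)%N.
    by rewrite leqNgt !nth_conj_part // -leqNgt.
  exists (Sub c' c's) => //; rewrite /conj_cell_pos SubK /=.
  by case: (c) => i j; congr pair; apply/val_inj.
- move=> T; apply: eq_forallb => c; apply: eq_forallb => d; rewrite /aligned -!val_eqE /=.
  by rewrite orbC.
- move=> T c; rewrite varE /cell_wt_dl /has_down /has_left !exists_equal_cells //.
  rewrite opprK mpolyCN; congr (_ + _).
    by congr (if _ then _ else _); apply: eq_existsb => d;
      rewrite -!val_eqE /= andbA [X in X && _]andbC.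
  by congr (if _ then _ else _); apply: eq_existsb => d;
      rewrite -!val_eqE /= andbA [X in X && _]andbC.
Qed.
End DualGroth.
End Partitions.

(** * Symmetry in the variables and the involution *)

Section MpolyFacts.

Lemma eq_mpoly_rmorph (R S : comNzRingType) d (f g : {rmorphism {mpoly R[d]} -> S}) :
  (forall r, f r%:MP = g r%:MP) -> (forall i, f 'X_i = g 'X_i) -> f =1 g.
Proof.
move=> fgC fgX; elim/mpolyind => [|c m p _ _ IH]; first by rewrite !rmorph0.
rewrite -mul_mpolyC !rmorphD !rmorphM /= IH fgC; congr (_ * _ + _).
rewrite mpolyXE_id !rmorph_prod; apply: eq_bigr => i _.
by rewrite !rmorphXn /= fgX.
Qed.

Lemma rmorph_mesym (R S T : comNzRingType) n (f : {rmorphism {mpoly R[n]} -> T})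
    (g : {rmorphism {mpoly S[n]} -> T}) k :
  (forall i, f 'X_i = g 'X_i) -> f (mesym n R k) = g (mesym n S k).
Proof.
move=> fgX; rewrite !mesymE !rmorph_sum; apply: eq_bigr => A _.
by rewrite !mpolyXE_id !rmorph_prod; apply: eq_bigr => i _; rewrite !rmorphXn /= fgX.
Qed.

Lemma msizeM_le_deg (R : comNzRingType) n d e (p q : {mpoly R[n]}) :
  (msize p <= d.+1)%N -> (msize q <= e.+1)%N -> (msize (p * q) <= (d + e).+1)%N.
Proof.
move=> pd qe; apply: msize_le => m dem; apply: memN_msupp_eq0; apply/negP.
move=> /msuppM_le/allpairsP[[m1 m2] /= [/msize_mdeg_lt m1p /msize_mdeg_lt m2q em]].
move: dem; rewrite em mdegD leqNgt ltnS leq_add //.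
  by rewrite -ltnS (leq_trans m1p).
by rewrite -ltnS (leq_trans m2q).
Qed.

Lemma msize_prod_le (R : comNzRingType) n (I : Type) (s : seq I) (P : pred I)
    (d : I -> nat) (F : I -> {mpoly R[n]}) :
  (forall i, P i -> msize (F i) <= (d i).+1)%N ->
  (msize (\prod_(i <- s | P i) F i) <= (\sum_(i <- s | P i) d i).+1)%N.
Proof.
move=> Fd; elim/big_rec2: _ => [|i e p Pi pe]; first by rewrite msize1.
by apply: msizeM_le_deg => //; apply: Fd.
Qed.

Lemma mcoeff_mwiden (R : comNzRingType) n (p : {mpoly R[n]}) m :
  (mwiden p)@_m = if m ord_max == 0%N
    then p@_[multinom m (widen_ord (leqnSn n) i) | i < n] else 0.
Proof.
elim/mpolyind: p => [|c m' p _ _ IH]; first by rewrite mwiden0 !mcoeff0 if_same.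
rewrite mwidenD mwidenZ mwidenX !mcoeffD !mcoeffZ {}IH !mcoeffX.
have -> : (mnmwiden m' == m) = (m ord_max == 0%N) &&
    (m' == [multinom m (widen_ord (leqnSn n) i) | i < n]).
  apply/eqP/andP => [<-|[/eqP m0 /eqP ->]].
    rewrite mnmwiden_ordmax eqxx; split=> //; apply/eqP/mnmP => i.
    by rewrite mnmE mnmwiden_widen.
  apply/mnmP => i; case: (unliftP ord_max i) => [j ->|->].
    by rewrite lift_max_widen mnmwiden_widen mnmE.
  by rewrite mnmwiden_ordmax m0.
by case: eqP => _ //=; rewrite mulr0 addr0.
Qed.

(** A monomial either avoids the last variable or is divisible by it. *)
Lemma mhsymSS (R : comNzRingType) n k :
  mhsym R n.+1 k.+1 = mwiden (mhsym R n k.+1) + 'X_ord_max * mhsym R n.+1 k.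
Proof.
apply/mpolyP => m; rewrite mcoeffD mcoeff_mwiden !mcoeff_mhsym.
have [m0|m0] := eqVneq (m ord_max) 0%N.
  have -> : ('X_ord_max * mhsym R n.+1 k)@_m = 0.
    apply: memN_msupp_eq0; apply/negP => /msuppM_le/allpairsP[[m1 m2] /= [+ _ em]].
    by rewrite msuppX inE => /eqP m1E; move: m0; rewrite em m1E mnmDE mnm1E eqxx.
  rewrite addr0; congr ((_ == _)%:R); rewrite !mdegE big_ord_recr /= m0 addn0.
  by apply: eq_bigr => i _; rewrite mnmE.
have le : (U_(ord_max) <= m)%MM.
  by apply/mnm_lepP => i; rewrite mnm1E; case: eqP => // <-; rewrite lt0n.
rewrite add0r mulrC -{2}(submK le) [(_ - _ + _)%MM]addmC mcoeffMX mcoeff_mhsym.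
by rewrite -{1}(submK le) mdegD mdeg1 addn1 eqSS.
Qed.

Lemma mhsym0 (R : comNzRingType) n : mhsym R n 0 = 1.
Proof. by apply/mpolyP => m; rewrite mcoeff_mhsym mcoeff1 mdeg_eq0. Qed.
End MpolyFacts.

Section Functoriality.
Variables (a b : nat).
Notation shape := {ffun 'I_a -> 'I_b.+1}.

Lemma map_kmx (R S : Type) (f : R -> S) (K : shape -> shape -> R) :
  map_mx f (kmx K) = kmx (fun la mu => f (K la mu)).
Proof. by apply/matrixP => i j; rewrite !mxE. Qed.

Lemma map_bi_mx (R S : comNzRingType) (f : {rmorphism R -> S}) alpha beta x y :
  map_mx f (bi_mx a b alpha beta x y) = bi_mx a b (f \o alpha) (f \o beta) (f x) (f y).
Proof.
rewrite map_kmx; apply: kmx_eq => la mu; rewrite /skew_kernel.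
case: eqP => _; first exact: rmorph1.
case: ifP => _; last exact: rmorph0.
rewrite rmorph_prod; apply: eq_bigr => i _; rewrite rmorph_prod; apply: eq_bigr => j _.
by rewrite rmorphB; congr (_ - _); case: ifP.
Qed.

Lemma eq_bi_mx (R : comNzRingType) (alpha beta alpha' beta' : nat -> R) x y :
  alpha =1 alpha' -> beta =1 beta' ->
  bi_mx a b alpha beta x y = bi_mx a b alpha' beta' x y.
Proof.
move=> ea eb; apply: kmx_eq => la mu; rewrite /skew_kernel; do 2!case: ifP => // _.
by apply: eq_bigr => i _; apply: eq_bigr => j _; rewrite ea eb.
Qed.

Section Products.
Variables (R : comNzRingType) (alpha beta : nat -> R).

Definition ur_prod (x : nat -> R) n := level_prod (cell_wt_ur (a:=a) (b:=b) alpha beta) x n.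
Definition dl_prod (x : nat -> R) n := level_prod (cell_wt_dl (a:=a) (b:=b) alpha beta) x n.

Lemma ur_prodS x n : ur_prod x n.+1 = bi_mx a b alpha beta (x n) 0 *m ur_prod x n.
Proof. by rewrite /ur_prod /= level_mx_ur. Qed.

Lemma dl_prodS x n : dl_prod x n.+1 = bi_mx a b alpha beta 0 (- x n) *m dl_prod x n.
Proof. by rewrite /dl_prod /= level_mx_dl. Qed.

End Products.

Lemma eq_ur_prod (R : comNzRingType) (alpha beta x alpha' beta' x' : nat -> R) n :
  alpha =1 alpha' -> beta =1 beta' -> (forall k, (k < n)%N -> x k = x' k) ->
  ur_prod alpha beta x n = ur_prod alpha' beta' x' n.
Proof.
move=> ea eb; elim: n => // n IH ex; rewrite !ur_prodS ex // IH => [|k kn].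
  by rewrite (eq_bi_mx _ _ ea eb).
by rewrite ex // ltnW.
Qed.

Lemma eq_dl_prod (R : comNzRingType) (alpha beta x alpha' beta' x' : nat -> R) n :
  alpha =1 alpha' -> beta =1 beta' -> (forall k, (k < n)%N -> x k = x' k) ->
  dl_prod alpha beta x n = dl_prod alpha' beta' x' n.
Proof.
move=> ea eb; elim: n => // n IH ex; rewrite !dl_prodS ex // IH => [|k kn].
  by rewrite (eq_bi_mx _ _ ea eb).
by rewrite ex // ltnW.
Qed.

Lemma map_ur_prod (R S : comNzRingType) (f : {rmorphism R -> S}) alpha beta x n :
  map_mx f (ur_prod alpha beta x n) = ur_prod (f \o alpha) (f \o beta) (f \o x) n.
Proof.
elim: n => [|n IH]; first by rewrite /ur_prod /= map_mx1.
by rewrite !ur_prodS map_mxM map_bi_mx IH rmorph0.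
Qed.

Lemma map_dl_prod (R S : comNzRingType) (f : {rmorphism R -> S}) alpha beta x n :
  map_mx f (dl_prod alpha beta x n) = dl_prod (f \o alpha) (f \o beta) (f \o x) n.
Proof.
elim: n => [|n IH]; first by rewrite /dl_prod /= map_mx1.
by rewrite !dl_prodS map_mxM map_bi_mx IH rmorph0 rmorphN.
Qed.

Definition seq_prod (R : comNzRingType) (alpha beta : nat -> R) (s : seq R) :=
  foldr (fun x M => bi_mx a b alpha beta x 0 *m M) 1%:M s.

Lemma ur_prod_seq (R : comNzRingType) (alpha beta x : nat -> R) n :
  ur_prod alpha beta x n = seq_prod alpha beta (map x (rev (iota 0 n))).
Proof.
elim: n => // n IH; rewrite ur_prodS IH.
by rewrite -[n.+1]addn1 iotaD rev_cat.
Qed.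

Lemma seq_prod_cat_cons (R : comNzRingType) (alpha beta : nat -> R) s x t :
  seq_prod alpha beta (s ++ x :: t) = seq_prod alpha beta (x :: s ++ t).
Proof. by elim: s => //= y s ->; rewrite /= !mulmxA bi_mx_comm. Qed.

Lemma seq_prod_perm (R : comNzRingType) (alpha beta : nat -> R) s t :
  perm_eq s t -> seq_prod alpha beta s = seq_prod alpha beta t.
Proof.
elim: s t => [|x s IH] t st; first by rewrite perm_sym in st; rewrite (perm_nilP st).
have xt : x \in t by rewrite -(perm_mem st) mem_head.
case/splitPr: xt st => t1 t2 st; rewrite seq_prod_cat_cons /= (IH (t1 ++ t2)) //.
by rewrite -(perm_cons x) (perm_trans st) // -[x :: t2]cat1s perm_catCA.
Qed.
End Functoriality.

(** * The matrix of all g as polynomials in the e_k, and its image under omega *)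

Section SymmetricFunctions.
Variables (a b : nat) (R : comNzRingType) (alpha beta : nat -> R).
Notation shape := {ffun 'I_a -> 'I_b.+1}.
Implicit Types (la mu nu : shape).

Definition ur_mx n : 'M[{mpoly R[n]}]_#|{: shape}| :=
  ur_prod a b (@mpolyC n R \o alpha) (@mpolyC n R \o beta) (var R n) n.

Lemma msymXU n (s : perm.perm_of 'I_n) (i : 'I_n) :
  msym s 'X_i = 'X_(perm.fun_of_perm s i) :> {mpoly R[n]}.
Proof.
rewrite msymX; congr 'X_[_]; apply/mnmP => j; rewrite mnmE !mnm1E.
by rewrite -(canF_eq (perm.permK s)) .
Qed.

(** Permuting the variables permutes the commuting factors P(x_i, 0). *)
Lemma ur_mx_sym n (s : perm.perm_of 'I_n) : map_mx (msym s) (ur_mx n) = ur_mx n.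
Proof.
rewrite /ur_mx map_ur_prod.
transitivity (ur_prod a b (@mpolyC n R \o alpha) (@mpolyC n R \o beta) (msym s \o var R n) n).
  by apply: eq_ur_prod => // k /=; rewrite -[_%:MP]mulr1 mul_mpolyC msymZ rmorph1.
rewrite !ur_prod_seq; apply: seq_prod_perm.
have iotaE (h : nat -> {mpoly R[n]}) :
    map h (rev (iota 0 n)) = map (h \o val) (rev (enum 'I_n)).
  by rewrite -val_enum_ord -map_rev -map_comp.
rewrite !iotaE; have -> : map ((msym s \o var R n) \o val) (rev (enum 'I_n)) =
          map (var R n \o val) (map (perm.fun_of_perm s) (rev (enum 'I_n))).
  by rewrite -map_comp; apply: eq_map => i; rewrite /= !varE msymXU.
apply/perm_map/uniq_perm => [||i].
- by rewrite (map_inj_uniq (@perm.perm_inj _ s)) rev_uniq enum_uniq.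
- by rewrite rev_uniq enum_uniq.
rewrite mem_rev mem_enum; apply/mapP.
exists (perm.fun_of_perm (perm.perm_inv s) i); first by rewrite mem_rev mem_enum.
by rewrite (perm.permKV s).
Qed.

(** The factor of the last variable becomes P(0, 0) = 1. *)
Lemma ur_mx_restr n : map_mx (@mrestr R n) (ur_mx n.+1) = ur_mx n.
Proof.
rewrite /ur_mx map_ur_prod ur_prodS /=.
have -> : mrestr (var R n.+1 n) = 0.
  by rewrite -[n in var _ _ n]/(nat_of_ord (@ord_max n)) varE mrestrXU unlift_none.
rewrite bi_mx_diag mul1mx; apply: eq_ur_prod => [k|k|k kn] /=.
- exact: comp_mpolyC.
- exact: comp_mpolyC.
rewrite -[k]/(nat_of_ord (Ordinal kn)) varE.
rewrite -[X in mrestr (var _ _ X)]/(nat_of_ord (widen_ord (leqnSn n) (Ordinal kn))) varE.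
by rewrite -lift_max_widen mrestrXU liftK.
Qed.

Definition weight la := (\sum_i la i)%N.

Lemma msize_le2 n x y : x = 0 \/ (exists r, x = r%:MP) \/ (exists i, x = 'X_i) ->
  (exists r, y = r%:MP) -> (msize (x - y : {mpoly R[n]}) <= 2)%N.
Proof.
move=> xE [r ->]; have sC (c : R) : (msize (c%:MP : {mpoly R[n]}) <= 2)%N.
  by rewrite msizeC; case: eqP.
apply: leq_trans (msizeD_le _ _) _; rewrite geq_max msizeN sC andbT.
case: xE => [->|[[r' ->]|[i ->]]]; first by rewrite msize0.
  exact: sC.
by rewrite mmeasureX /= mdeg1.
Qed.

Lemma msize_bi_mx n k la mu :
  let p := bi_mx a b (@mpolyC n R \o alpha) (@mpolyC n R \o beta) (var R n k) 0
             (enum_rank la) (enum_rank mu) in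
  p = 0 \/ (weight mu <= weight la)%N /\ (msize p <= (weight la - weight mu).+1)%N.
Proof.
rewrite /= kmxE /skew_kernel; case: eqP => [->|_].
  by right; rewrite leqnn subnn msize1.
case: ifP => [/and3P[_ _ /forallP ml]|_]; last by left.
right; split; first exact: leq_sum.
rewrite /weight -sumnB //; apply: msize_prod_le => i _.
rewrite /row_wt -!rowsE -[X in (_ <= X.+1)%N]muln1 -sum_nat_const_nat.
apply: msize_prod_le => j _; apply: msize_le2.
  case: ifP => _; first by right; left; exists (beta i.-1).
  rewrite /var; case: insubP => [o _ _|_]; last by left.
  by right; right; exists o.
by case: ifP => _; [exists (alpha j)|exists 0; rewrite mpolyC0].
Qed.

Lemma msize_ur_mx n la mu :
  let p := ur_mx n (enum_rank la) (enum_rank mu) in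
  p = 0 \/ (weight mu <= weight la)%N /\ (msize p <= (weight la - weight mu).+1)%N.
Proof.
suff gen k : let p := ur_prod a b (@mpolyC n R \o alpha) (@mpolyC n R \o beta) (var R n) k
      (enum_rank la) (enum_rank mu) in
    p = 0 \/ (weight mu <= weight la)%N /\ (msize p <= (weight la - weight mu).+1)%N.
  exact: gen.
cbv zeta; elim: k la => [|k IH] la.
  rewrite /ur_prod /= mxE (inj_eq enum_rank_inj); case: eqP => [->|_]; last by left.
  by right; rewrite leqnn subnn msize1.
rewrite ur_prodS [ur_prod _ _ _ _ _ _]kmxP [bi_mx _ _ _ _ _ _]kmxP kmx_mul kmxE.
set G := bi_mx _ _ _ _ _ _; set M := ur_prod _ _ _ _ _ _.
have step nu : let p := G (enum_rank la) (enum_rank nu) * M (enum_rank nu) (enum_rank mu) in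
    p = 0 \/ (weight mu <= weight la)%N /\ (msize p <= (weight la - weight mu).+1)%N.
  have [-> | [nl sG]] := msize_bi_mx n k la nu; first by left; rewrite mul0r.
  have [-> | [mn sM]] := IH nu; first by left; rewrite mulr0.
  right; split; first exact: leq_trans nl.
  by have := msizeM_le_deg sG sM; rewrite addnBA // subnK.
have [ml|nml] := boolP (weight mu <= weight la)%N; last first.
  left; rewrite big1 // => nu _; case: (step nu) => [//|[ml _]].
  by rewrite ml in nml.
right; split=> //; apply: (leq_trans (msize_sum _ _ _)); apply/bigmax_leqP => nu _.
by case: (step nu) => [->|[_ //]]; rewrite msize0.
Qed.

(** Each cell of the box contributes degree at most 1 and [msize] is the degree plus one, so this
    bounds all entries for every number of variables; hence e_1, ..., e_d suffice to express
    them. *)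
Definition max_deg := (a * b).+1.

Lemma msize_ur_mx_le n la mu :
  (msize (ur_mx n (enum_rank la) (enum_rank mu)) <= max_deg)%N.
Proof.
have [-> | [_ /leq_trans]] := msize_ur_mx n la mu; first by rewrite msize0.
apply; rewrite ltnS (leq_trans (leq_subr _ _)) // /weight.
apply: (@leq_trans (\sum_(i < a) b)%N); first by apply: leq_sum => i _; apply: leq_ord.
by rewrite sum_nat_const card_ord.
Qed.

Lemma ur_symfun_proof la mu :
  issymfun (fun n => ur_mx n (enum_rank la) (enum_rank mu)).
Proof.
apply/boolp.asboolP; split=> [n|n|]; last by exists max_deg => n; apply: msize_ur_mx_le.
  by apply/issymP => s; rewrite -[in RHS](ur_mx_sym s) [RHS]mxE.
by rewrite -[in RHS]ur_mx_restr [RHS]mxE.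
Qed.

Definition ur_symfun la mu : symfun R := SymFun (ur_symfun_proof la mu).

Notation d := max_deg.

(* [ur_mx n] is [tau] evaluated at [e_k(x_1..x_n)]. *)
Definition tau : 'M[{mpoly R[d]}]_#|{: shape}| :=
  kmx (fun la mu => symf (sf_spec d (ur_symfun la mu))).

Lemma ur_symfunE la mu :
  ur_symfun la mu = sf_eval (sym_e R) (tau (enum_rank la) (enum_rank mu)).
Proof.
by rewrite kmxE; apply: (@sf_eval_symf _ _ d) => // n; apply: msize_ur_mx_le.
Qed.

Lemma tau_mesym n :
  map_mx (comp_mpoly [tuple mesym n R i.+1 | i < d]) tau = ur_mx n.
Proof.
apply/matrixP => i j; rewrite mxE -[i]enum_valK -[j]enum_valK.
have := congr1 (sf_spec n) (ur_symfunE (enum_val i) (enum_val j)).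
by rewrite sf_eval_spec => <-.
Qed.

Lemma comp_mesymXU (S : comNzRingType) n (i : 'I_d) :
  'X_i \mPo [tuple mesym n S i.+1 | i < d] = mesym n S i.+1.
Proof. by rewrite comp_mpolyXU -tnth_nth tnth_mktuple. Qed.

Lemma comp_mhsymXU (S : comNzRingType) n (i : 'I_d) :
  'X_i \mPo [tuple mhsym S n i.+1 | i < d] = mhsym S n i.+1.
Proof. by rewrite comp_mpolyXU -tnth_nth tnth_mktuple. Qed.

(* Adding a variable [y] to an alphabet replaces [e_k] by [e_k + y e_(k-1)]; since *)
(* the [e_k] are algebraically independent, the resulting identity holds for       *)
(* arbitrary values [c k] of the [e_k].                                             *)
Section AddVariable.
Variables (B : comNzRingType) (f g : {rmorphism {mpoly R[d]} -> B}) (c : nat -> B) (y : B).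
Hypotheses (fgC : forall r, f r%:MP = g r%:MP) (c0 : c 0%N = 1).
Hypothesis gX : forall i : 'I_d, g 'X_i = c i.+1.
Hypothesis fX : forall i : 'I_d, f 'X_i = c i.+1 + y * c i.

Let coef : {rmorphism R -> B} := g \o @mpolyC d R.
Let coefU : {rmorphism R -> {mpoly B[d]}} := @mpolyC d B \o coef.
Let gen k : {mpoly B[d]} := if k is k'.+1 then var B d k' else 1.
Let gU : {rmorphism {mpoly R[d]} -> {mpoly B[d]}} := map_mpoly coef.
Let fU : {rmorphism {mpoly R[d]} -> {mpoly B[d]}} :=
  mmap coefU (fun i : 'I_d => 'X_i + y%:MP * gen i).
Let evU : {rmorphism {mpoly B[d]} -> B} := meval (fun i => g 'X_i).
Let symU : {rmorphism {mpoly B[d]} -> {mpoly B[d]}} :=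
  comp_mpoly [tuple mesym d B i.+1 | i < d].
Let lastU : {rmorphism {mpoly R[d.+1]} -> {mpoly B[d]}} :=
  mmap coefU (fun i => oapp (fun j : 'I_d => 'X_j) y%:MP (unlift ord_max i)).

Let evU_f : evU \o fU =1 f.
Proof.
apply: eq_mpoly_rmorph => [r|i] /=.
  by rewrite mmapC /= /evU /= mevalC fgC.
rewrite mmapX mmap1U rmorphD rmorphM /= mevalXU mevalC gX fX; congr (_ + _ * _).
case: (i : nat) (ltn_ord i) => [|k] kd; first by rewrite /= meval1 c0.
by rewrite /= -[k]/(nat_of_ord (Ordinal (ltnW kd))) varE mevalXU gX.
Qed.

Let evU_g : evU \o gU =1 g.
Proof.
apply: eq_mpoly_rmorph => [r|i] /=; first by rewrite map_mpolyC mevalC.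
by rewrite map_mpolyX mevalXU.
Qed.

Let gU_mesym k : gU (mesym d R k) = mesym d B k.
Proof.
apply: (rmorph_mesym (f := gU) (g := idfun)) => i /=.
exact: map_mpolyX.
Qed.

Let lastU_mwiden : lastU \o @mwiden d R =1 gU.
Proof.
apply: eq_mpoly_rmorph => [r|i] /=; first by rewrite mwidenC mmapC map_mpolyC.
by rewrite mwidenX mnmwiden1 mmapX mmap1U -lift_max_widen liftK map_mpolyX.
Qed.

(** This is the recurrence [mesymSS] for e_(i+1) in one more variable, with that variable set to
    [y]. *)
Let symU_f : symU \o fU =1 lastU \o comp_mpoly [tuple mesym d.+1 R i.+1 | i < d].
Proof.
apply: eq_mpoly_rmorph => [r|i] /=.
  by rewrite /symU /= comp_mpolyC !mmapC /= comp_mpolyC.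
rewrite comp_mesymXU mesymSS rmorphD rmorphM /=.
rewrite [mmap _ _ (mwiden (mesym d R i.+1))](lastU_mwiden _) gU_mesym.
rewrite [mmap _ _ (mwiden (mesym d R i))](lastU_mwiden _) gU_mesym.
rewrite !mmapX !mmap1U unlift_none /= rmorphD rmorphM /= comp_mesymXU comp_mpolyC mulrC.
congr (_ + _ * _).
case: (i : nat) (ltn_ord i) => [|k] kd; first by rewrite /= rmorph1 mesym0E.
by rewrite /= -[k in var _ _ k]/(nat_of_ord (Ordinal (ltnW kd))) varE comp_mesymXU.
Qed.

Let symU_g : symU \o gU =1 gU \o comp_mpoly [tuple mesym d R i.+1 | i < d].
Proof.
apply: eq_mpoly_rmorph => [r|i] /=.
  by rewrite /symU /= comp_mpolyC !map_mpolyC comp_mpolyC.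
by rewrite comp_mesymXU [RHS]gU_mesym map_mpolyX /symU /= comp_mesymXU.
Qed.

Lemma tau_add_var :
  map_mx f tau = bi_mx a b (coef \o alpha) (coef \o beta) y 0 *m map_mx g tau.
Proof.
(* The universal case, where the values [c k] with k > 0 are independent variables; [evU]
   specializes it at the end. *)
have EU : map_mx fU tau =
    bi_mx a b (coefU \o alpha) (coefU \o beta) y%:MP 0 *m map_mx gU tau.
  have symU_inj : injective (map_mx symU : 'M_#|{: shape}| -> 'M_#|{: shape}|).
    move=> M N MN; apply/matrixP => i j; apply: msym_fundamental_un.
    by have := congr1 (fun M : 'M_#|{: shape}| => M i j) MN; rewrite !mxE.
  apply: symU_inj; rewrite map_mxM -!map_mx_comp.
  rewrite [LHS](eq_map_mx _ symU_f) [X in _ = _ *m X](eq_map_mx _ symU_g).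
  rewrite (map_mx_comp (comp_mpoly _) lastU) (map_mx_comp (comp_mpoly _) gU) !tau_mesym.
  rewrite /ur_mx !map_ur_prod ur_prodS map_bi_mx rmorph0.
  have -> : symU y%:MP = y%:MP by exact: comp_mpolyC.
  have -> : (lastU \o var R d.+1) d = y%:MP.
    by rewrite /= -[d in var _ _ d]/(nat_of_ord (@ord_max d)) varE mmapX mmap1U unlift_none.
  have lastC r : lastU r%:MP = coefU r by exact: mmapC.
  have gC r : gU r%:MP = coefU r by exact: map_mpolyC.
  have symC r : symU (coefU r) = coefU r by exact: comp_mpolyC.
  have Ebi : bi_mx a b (lastU \o (@mpolyC d.+1 R \o alpha)) (lastU \o (@mpolyC d.+1 R \o beta))
      y%:MP 0 = bi_mx a b (symU \o (coefU \o alpha)) (symU \o (coefU \o beta)) y%:MP 0.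
    by apply: eq_bi_mx => k; apply: (etrans (lastC _) (esym (symC _))).
  rewrite Ebi; apply: (congr1 (mulmx _)); apply: eq_ur_prod => [k|k|k kd].
  - exact: etrans (lastC _) (esym (gC _)).
  - exact: etrans (lastC _) (esym (gC _)).
  rewrite /=.
  rewrite -[k in var R d k]/(nat_of_ord (Ordinal kd)) varE map_mpolyX.
  rewrite -[k in var _ _ k]/(nat_of_ord (widen_ord (leqnSn d) (Ordinal kd))) varE.
  by rewrite mmapX mmap1U -lift_max_widen liftK.
have := congr1 (map_mx evU) EU.
rewrite map_mxM -!map_mx_comp (eq_map_mx _ evU_f) (eq_map_mx _ evU_g) => ->.
congr (_ *m _); rewrite map_bi_mx rmorph0.
have evC r : evU r%:MP = r by exact: mevalC.
by rewrite evC; apply: eq_bi_mx => k /=; rewrite [LHS]evC.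
Qed.
End AddVariable.

Definition dl_mx n : 'M[{mpoly R[n]}]_#|{: shape}| :=
  dl_prod a b (@mpolyC n R \o alpha) (@mpolyC n R \o beta) (var R n) n.

(* Apply [tau_add_var] to [h_k(x_1..x_n) = h_k(x_1..x_(n+1)) - x_(n+1) h_(k-1)(x_1..x_(n+1))]. *)
Lemma tau_mhsym n :
  map_mx (comp_mpoly [tuple mhsym R n i.+1 | i < d]) tau = dl_mx n.
Proof.
elim: n => [|n IH].
  (* Without variables, all e_k and h_k with k > 0 vanish, so [tau_mesym] gives the identity
     matrix. *)
  have h0 : comp_mpoly [tuple mhsym R 0 i.+1 | i < d] =1
            comp_mpoly [tuple mesym 0 R i.+1 | i < d].
    apply: eq_mpoly_rmorph => [r|i]; first by rewrite /= !comp_mpolyC.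
    rewrite /=.
    rewrite comp_mhsymXU comp_mesymXU mesym_geqnE //.
    by apply/mpolyP => m; rewrite mcoeff_mhsym mcoeff0 mdegE big_ord0.
  by rewrite (eq_map_mx _ h0) tau_mesym.
pose f : {rmorphism {mpoly R[d]} -> {mpoly R[n.+1]}} :=
  @mwiden n R \o comp_mpoly [tuple mhsym R n i.+1 | i < d].
pose g : {rmorphism {mpoly R[d]} -> {mpoly R[n.+1]}} :=
  comp_mpoly [tuple mhsym R n.+1 i.+1 | i < d].
have fgC r : f r%:MP = g r%:MP by rewrite /f /g /= !comp_mpolyC mwidenC.
have gX (i : 'I_d) : g 'X_i = mhsym R n.+1 i.+1 by exact: comp_mhsymXU.
have fX (i : 'I_d) : f 'X_i = mhsym R n.+1 i.+1 + (- 'X_ord_max) * mhsym R n.+1 i.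
  by rewrite /f /= comp_mhsymXU mhsymSS mulNr addrK.
have := tau_add_var fgC (mhsym0 R n.+1) gX fX.
rewrite {1}/f map_mx_comp IH /dl_mx map_dl_prod => E.
have gC r : g r%:MP = r%:MP by exact: comp_mpolyC.
have E' : dl_prod a b (@mpolyC n.+1 R \o alpha) (@mpolyC n.+1 R \o beta) (var R n.+1) n =
   bi_mx a b (@mpolyC n.+1 R \o alpha) (@mpolyC n.+1 R \o beta) (- 'X_ord_max) 0 *m map_mx g tau.
  have <- : bi_mx a b (g \o @mpolyC d R \o alpha) (g \o @mpolyC d R \o beta) (- 'X_ord_max) 0 =
      bi_mx a b (@mpolyC n.+1 R \o alpha) (@mpolyC n.+1 R \o beta) (- 'X_ord_max) 0.
    by apply: eq_bi_mx => k; exact: gC.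
  rewrite -E; apply: eq_dl_prod => [k|k|k kn] /=; rewrite ?mwidenC //.
  rewrite -[k in RHS]/(nat_of_ord (Ordinal kn)) varE mwidenX mnmwiden1.
  by rewrite -[k]/(nat_of_ord (widen_ord (leqnSn n) (Ordinal kn))) varE.
(* The new factor P(0, -x) cancels P(-x, 0) from [E'], since their product is P(0, 0) = 1. *)
rewrite dl_prodS E' mulmxA -[n in var _ _ n]/(nat_of_ord (@ord_max n)) varE.
by rewrite bi_mx_mul bi_mx_diag mul1mx.
Qed.

Lemma omega_ur_symfun la mu n :
  sf_spec n (omega (ur_symfun la mu)) = dl_mx n (enum_rank la) (enum_rank mu).
Proof.
rewrite ur_symfunE omega_sf_eval sf_eval_spec -tau_mhsym [RHS]mxE.
congr comp_mpoly; apply: eq_from_tnth => i; rewrite !tnth_mktuple /=.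
by rewrite omega_e.
Qed.
End SymmetricFunctions.

Theorem theorem8p10 (la mu : seq nat)
    (hla : is_part la) (hmu : is_part mu) (hmula : subpart mu la) :
  exists g : symfun Zab,
    symfun_val g = dual_groth la mu alphaZ betaZ /\
    symfun_val (omega g) =
      dual_groth (conj_part la) (conj_part mu)
        (fun i => - betaZ i) (fun i => - alphaZ i).
Proof.
exists (ur_symfun alphaZ betaZ (shape_of la la) (shape_of la mu)); split.
  apply: boolp.functional_extensionality_dep => n; by rewrite dual_grothE.
apply: boolp.functional_extensionality_dep => n; rewrite dual_groth_conjE //.
exact: omega_ur_symfun.
Qed.
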